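(* Let $\mathbb{K}$ be a field and let $f_1,\dots,f_s\in\mathbb{K}[T_1,\dots,T_r]$ be generators of an ideal $I\subseteq\mathbb{K}[T_1,\dots,T_r]$. Then the algorithm ContainsMonomial (described in the context), applied to $f_1,\dots,f_s$, returns ''true'' if $T^\mu=T_1^{\mu_1}\cdots T_r^{\mu_r}\in I$ for some $\mu\in\mathbb{Z}_{\ge 0}^r$, and it returns ''false'' otherwise.
   Context: **Definitions** (over any field $F$, with lexicographic ordering $T_1>\dots>T_r$ on $F[T_1,\dots,T_r]$). Polynomials $f_1,\dots,f_s$ are of *triangular shape* if for each $f_j$ there is $1\le k(f_j)\le r$ such that $k(f_1)<\dots<k(f_s)$ and $f_j\in F[T_{k(f_j)},\dots,T_r]\setminus F[T_{k(f_j)+1},\dots,T_r]$ for each $j$. $\deg_{T_i}(f)$ is the degree of $f$ as a polynomial in $T_i$, and $\mathrm{LC}_{k(f)}(f)\in F[T_{k(f)+1},\dots,T_r]$ is the leading coefficient of $f$ as a polynomial in $T_{k(f)}$; more generally $\mathrm{LC}_{i}(f)$ is the leading coefficient of $f$ as a polynomial in $T_i$. A *semi-triangular system* is a tuple $(\mathcal{F}_\square,\mathcal{F}_\lhd,k,g)$ of finite subsets $\mathcal{F}_\square,\mathcal{F}_\lhd\subseteq F[T_1,\dots,T_r]$, an integer $0\le k\le r$ and a polynomial $g\in F[T_1,\dots,T_r]$ such that: $\mathcal{F}_\lhd$ is of triangular shape; $\mathrm{LC}_{k(f)}(f)\mid g$ for all $f\in\mathcal{F}_\lhd$; $\{1,\dots,k\}$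 contains $\{k(f): f\in\mathcal{F}_\lhd\}$; $\deg_{T_i}(f)=0$ for all $f\in\mathcal{F}_\square$ and $1\le i\le k$. It is a *triangular system* if $\mathcal{F}_\square\subseteq F$. A list of semi-triangular systems is a *triangle mush*. A triangular system $(\emptyset,\{f_1,\dots,f_s\},k,g)$ in a polynomial ring $F[T_{k_1},\dots,T_{k_s}]$ is *dense* if $\{k_1,\dots,k_s\}=\{k(f_1),\dots,k(f_s)\}$, and *monic* if $\mathrm{LC}_{k(f_i)}(f_i)=1$ for all $i$. $\mathrm{LT}$ denotes the leading term (of a polynomial, or of the elements of a set) with respect to the ordering. The *reduction* of a finite set $\mathcal{F}$ of polynomials is a finite set $\mathrm{red}(\mathcal{F})$ of polynomials such that $\mathrm{LT}(f_1)\nmid\mathrm{LT}(f_2)$ for all distinct $f_1,f_2\in\mathrm{red}(\mathcal{F})$, $\langle\mathrm{LT}(\mathcal{F})\rangle\subseteq\langle\mathrm{LT}(\mathrm{red}(\mathcal{F}))\rangle$ and $\langle\mathcal{F}\rangle=\langle\mathrm{red}(\mathcal{F})\rangle$. Computing it means successively applying the division algorithm to the elements of $\mathcal{F}$. **MakeTriangular.** Input: a triangle mush $\mathcal{S}$ in $\mathbb{K}[T_1,\dots,T_r]$. While there is $S=(\mathcal{F}_\square,\mathcal{F}_\lhd,k,g)\in\mathcal{S}$ with $k<r$: replace $\mathcal{F}_\square$ by $\mathrm{red}(\mathcal{F}_\square)$; then do the following. (a) If there is $f\in\mathcal{F}_\square$ with $\deg_{T_{k+1}}(f)>0$ and there is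 $h\in\mathcal{F}_\square\setminus\{f\}$ with $\deg_{T_{k+1}}(h)>0$: perform a polynomial division of $f$ by $h$ in the univariate polynomial ring $\mathbb{K}(T_{k+2},\dots,T_r)[T_{k+1}]$ to obtain $f=a'h+u'$. Set $b:=\mathrm{LC}_{k+1}(h)\in\mathbb{K}[T_{k+2},\dots,T_r]$ and $j:=\deg_{T_{k+1}}(h)+1$. With $a:=b^ja'$ and $u:=b^ju'\in\mathbb{K}[T_{k+1},\dots,T_r]$ one then has $b^jf=ah+u\in\mathbb{K}[T_{k+1},\dots,T_r]$. Replace $S$ in $\mathcal{S}$ by the two systems $((\mathcal{F}_\square\setminus\{f\})\cup\{u\},\mathcal{F}_\lhd,k,bg)$ and $(\mathcal{F}_\square\cup\{b\},\mathcal{F}_\lhd,k,g)$. (b) If there is such an $f$ but no such $h$: write $f=\sum_{i=0}^d a_iT_{k+1}^i$ with $a_i\in\mathbb{K}[T_{k+2},\dots,T_r]$, and for $-1\le j\le d$ put $f_j:=\sum_{i=0}^ja_iT_{k+1}^i$, $\mathcal{F}_\lhd^j:=\mathcal{F}_\lhd\cup\{f_j\}$ and $\mathcal{F}_\square^j:=(\mathcal{F}_\square\setminus\{f\})\cup\{a_{j+1},\dots,a_d\}$. Replace $S$ in $\mathcal{S}$ by $S',S_1,\dots,S_d$, where $S':=(\mathcal{F}_\square^{-1},\mathcal{F}_\lhd,k+1,g)$ and $S_j:=(\mathcal{F}_\square^j,\mathcal{F}_\lhd^j,k+1,ga_j)$ for $1\le j\le d$. (c) If there is no such $f$: replace $S$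 in $\mathcal{S}$ by $(\mathcal{F}_\square,\mathcal{F}_\lhd,k+1,g)$. Output: the final $\mathcal{S}$. **MakeMonic.** Input: a triangular system $(\emptyset,\mathcal{F}_\lhd,k,g)$ that is dense in $\mathbb{L}[T_1,\dots,T_r]$, $\mathbb{L}$ a field, with $\mathcal{F}_\lhd=\{f_1,\dots,f_r\}$ and $k(f_i)=i$. For $n=r$ down to $1$: set $\mathcal{F}_\lhd^n:=\{f_i: i>n\}\subseteq\mathbb{L}[T_{n+1},\dots,T_r]$; decompose $f_n=hT_n^d+c$ with $d\in\mathbb{Z}_{\ge1}$, $h\in\mathbb{L}[T_{n+1},\dots,T_r]$, $c\in\mathbb{L}[T_n,\dots,T_r]$ and $\deg_{T_n}(c)<d$; compute (by linear algebra) the monic minimal polynomial $p_h\in\mathbb{L}[X]$ over $\mathbb{L}$ of the class of $h$ in $\mathbb{L}[T_{n+1},\dots,T_r]/\langle\mathcal{F}_\lhd^n\rangle$; decompose $p_h=\beta X^{j+1}+\alpha X^j$ with $\beta\in\mathbb{L}[X]$, $\alpha\in\mathbb{L}^*$ by choosing $j\in\mathbb{Z}_{\ge0}$ maximal with $X^j\mid p_h$; define $h':=-\beta(h)/\alpha$; redefine $f_n$ as $T_n^d+h'c$ and let $S':=(\emptyset,\mathcal{F}_\lhd^n\cup\{f_n\},k,g)$. Output: the final $S'$. **IsSolvable.** Input: a triangular system $S=(\mathcal{F}_\square,\mathcal{F}_\lhd,k,g)$ in $\mathbb{K}[T_1,\dots,T_r]$. If $\mathcal{F}_\square\cap\mathbb{K}^*$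 is non-empty, return false. Otherwise (where $\mathcal{F}_\square=\{0\}$ is replaced by $\emptyset$) write $\mathcal{F}_\lhd=\{f_1,\dots,f_s\}$, $k_i:=k(f_i)$, $\mathbb{L}:=\mathbb{K}(T_i: i\notin\{k_1,\dots,k_s\})$, let $\iota\colon\mathbb{K}[T_1,\dots,T_r]\to\mathbb{L}[T_{k_1},\dots,T_{k_s}]$ be the canonical embedding, and consider the dense triangular system $\iota(S):=(\emptyset,\iota(\mathcal{F}_\lhd),s,\iota(g))$. Apply MakeMonic to $\iota(S)$ to obtain $(\emptyset,\mathcal{F}_\lhd',k',g')$. Determine (by linear algebra) the minimal polynomial $p_{g'}\in\mathbb{L}[X]$ of the residue class of $g'$ in $\mathbb{L}[T_{k_1},\dots,T_{k_s}]/\langle\mathcal{F}_\lhd'\rangle$. If $p_{g'}$ is a monomial, return false; otherwise return true. **ContainsMonomial.** Input: generators $f_1,\dots,f_s$ of $I$. Define the semi-triangular system $S:=(\mathcal{F}_\square,\emptyset,0,g)$ with $g:=T_1\cdots T_r$ and $\mathcal{F}_\square:=\{f_1,\dots,f_s\}$. Let $\mathcal{S}$ be the output of MakeTriangular applied to $\{S\}$. For each system in $\mathcal{S}$: if IsSolvable returns true, return false. If this happens for no system, return true.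
   Formalization: In (a), f and h are chosen with deg f ≥ deg h, and j is any exponent making a and u polynomials (deg h + 1 can fail: T_1^3 divided by T_1T_2−1; swapping the roles can loop forever). In (b), the S_j whose f_j does not involve T_{k+1} are left out, as they are not semi-triangular. *)

(* Defs.v *)
From HB Require Import structures.
From Stdlib Require Import Relations.
From mathcomp Require Import all_boot all_order all_algebra.
From mathcomp Require Import fraction finmap.
From mathcomp Require Import mpoly.

Set Implicit Arguments.
Unset Strict Implicit.
Unset Printing Implicit Defensive.

Import GRing.Theory.
Local Open Scope fset_scope.
Local Open Scope ring_scope.

(* The variables T_1 > ... > T_r are 'X_i for i : 'I_r, with T_(i+1) = 'X_i.  *)
(* Levels are counted as natural numbers 0 <= k <= r: "{T_1, ..., T_k}" is    *)
(* {'X_i | i < k}, and T_(k+1) is the variable 'X_i with i = k.               *)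

Section Polynomials.
Variables (F : fieldType) (r : nat).
Local Notation P := {mpoly F[r]}.
Implicit Types (f g h p q u : P) (i : 'I_r) (G : {fset P}).

Definition divides p q : Prop := exists c, q = c * p.

(* f as an element of F[T_j : j <> i][T_i] *)
Definition uni i f : {poly P} :=
  mmap (polyC \o @mpolyC r F) (fun j => if j == i then 'X else ('X_j)%:P) f.

Definition degT i f : nat := (size (uni i f)).-1.
Definition coefT i (l : nat) f : P := (uni i f)`_l.
Definition LC i f : P := lead_coef (uni i f).

(* f \in F[T_(k+1), ..., T_r] *)
Definition polyfrom (k : nat) f : bool :=
  [forall j : 'I_r, (j < k)%N ==> (degT j f == 0)%N].

(* k(f) = i *)
Definition pivot f i : bool := polyfrom i f && ~~ polyfrom i.+1 f.

Definition lexlt (m1 m2 : 'X_{1..r}) : bool :=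
  [exists i : 'I_r, (m1 i < m2 i)%N &&
     [forall j : 'I_r, (j < i)%N ==> (m1 j == m2 j)]].
Definition lexle m1 m2 : bool := (m1 == m2) || lexlt m1 m2.

(* The multinomials order, hence mlead, is graded; this is the leading        *)
(* monomial for the lexicographic one (0%MM if f = 0, and then LT f = 0).     *)
Definition lexlead f : 'X_{1..r} :=
  \big[(fun m1 m2 => if lexlt m1 m2 then m2 else m1)/0%MM]_(m <- msupp f) m.
Definition LT f : P := f@_(lexlead f) *: 'X_[lexlead f].

(* p \in <G>, the ideal being taken in F[T_(k+1), ..., T_r] *)
Definition ideal_from (k : nat) G p : Prop :=
  exists2 c : P -> P, {in G, forall g, polyfrom k (c g)}
                    & p = \sum_(g <- G) c g * g.
Definition ideal G p : Prop := ideal_from 0 G p.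

(* u is a remainder of f upon division by the elements of G *)
Definition remainder f G u : Prop :=
  exists q : P -> P,
    [/\ f = \sum_(g <- G) q g * g + u,
        {in G, forall g, q g * g != 0 -> lexle (lexlead (q g * g)) (lexlead f)}
      & {in msupp u, forall m,
          {in G, forall g, g != 0 -> ~~ (lexlead g <= m)%MM}}].

Inductive red_step G : {fset P} -> Prop :=
  RedStep f u of f \in G & remainder f (G `\ f) u :
    red_step G (if u == 0 then G `\ f else u |` (G `\ f)).

(* R is a possible value of red(G): it has the defining properties of a       *)
(* reduction and is computed by successive divisions.                         *)
Definition is_red G R : Prop :=
  [/\ clos_refl_trans _ red_step G R,
      {in R &, forall f1 f2, f1 != f2 -> ~ divides (LT f1) (LT f2)},
      (forall p, ideal [fset LT f | f in G] p -> ideal [fset LT f | f in R] p)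
    & (forall p, ideal G p <-> ideal R p)].

Definition triangular_shape G : Prop :=
  exists (s : nat) (f : 'I_s -> P) (k : 'I_s -> 'I_r),
    [/\ G = [fset f a | a : 'I_s], (forall a, pivot (f a) (k a))
      & (forall a b : 'I_s, (a < b)%N -> (k a < k b)%N)].

(* (F_square, F_triangle, k, g) *)
Record system := System {
  sq : {fset P};
  tri : {fset P};
  lvl : nat;
  gpol : P }.
Implicit Types S : system.

Definition semi_triangular S : Prop :=
  [/\ (lvl S <= r)%N, triangular_shape (tri S),
      {in tri S, forall f i, pivot f i -> divides (LC i f) (gpol S)},
      {in tri S, forall f i, pivot f i -> (i < lvl S)%N}
    & {in sq S, forall f i, (i < lvl S)%N -> degT i f = 0%N}].

Definition triangular S : Prop :=
  semi_triangular S /\ {in sq S, forall f, exists c : F, f = c%:MP}.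

(* p is the monic minimal polynomial over F of the class of h in              *)
(* F[T_(k+1), ..., T_r] / <G>.                                                *)
Definition is_minpoly (k : nat) G h (p : {poly F}) : Prop :=
  [/\ p \is monic, ideal_from k G (horner_alg h p)
    & forall q : {poly F}, q != 0 -> ideal_from k G (horner_alg h q) ->
        (size p <= size q)%N].

(* Pass of MakeMonic for the variable 'X_n: f is the input and f' the output  *)
(* family. Since the passes go down from n = r, the current value of f_n is   *)
(* the input one, and the current F^n consists of the final f'_i, i > n.      *)
Definition monic_pass (f f' : 'I_r -> P) (n : 'I_r) : Prop :=
  let d := degT n (f n) in
  let h := LC n (f n) in
  let c := f n - h * 'X_n ^+ d in
  exists (ph : {poly F}) (j : nat) (beta : {poly F}) (alpha : F),
    [/\ is_minpoly n.+1 [fset f' i | i : 'I_r & (n < i)%N] h ph,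
        alpha != 0,
        ph = beta * 'X^(j.+1) + alpha *: 'X^j
      & let h' := - (alpha^-1 *: horner_alg h beta) in
        f' n = 'X_n ^+ d + h' * c].

Definition MakeMonic S S' : Prop :=
  exists f f' : 'I_r -> P,
    [/\ tri S = [fset f i | i : 'I_r], (forall i, pivot (f i) i),
        (forall n, monic_pass f f' n)
      & S' = System fset0 [fset f' i | i : 'I_r] (lvl S) (gpol S)].

(* coefficients in the fraction field; the coefficients of f with respect to  *)
(* T_i lie in the polynomial ring without T_i                                 *)
Definition uniF i f : {poly {fraction P}} :=
  map_poly (@FracField.tofrac P) (uni i f).

(* sum_(l < n) a_l T_i^l, that is f_(n-1) *)
Definition head_part i f (n : nat) : P := \sum_(l < n) coefT i l f * 'X_i ^+ l.
(* {a_n, ..., a_d} *)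
Definition tail_coefs i f (n : nat) : {fset P} :=
  [fset coefT i l f | l in iota n ((degT i f).+1 - n)].

Definition branch_last S i f : system :=
  System ((sq S `\ f) `|` tail_coefs i f 0) (tri S) (lvl S).+1 (gpol S).
Definition branch S i f (j : nat) : system :=
  System ((sq S `\ f) `|` tail_coefs i f j.+1) (head_part i f j.+1 |` tri S)
    (lvl S).+1 (gpol S * coefT i j f).

(* split_step S i M: M is a possible replacement of S in steps (a), (b), (c),  *)
(* for 'X_i the variable T_(k+1) and F_square already reduced.                *)
(* - In (a), f = a' h + u' is divided by h, where b = LC h. Of the two        *)
(*   polynomials involving T_(k+1), f is one of degree at least that of h     *)
(*   (otherwise a' = 0 and the loop might not end). The exponent j may be any *)
(*   one for which b^j a' and b^j u' are polynomials: deg h + 1 whenever it   *)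
(*   clears the denominators (it does not always), and deg f - deg h + 1      *)
(*   always. The division is in K(T_(k+2), ..., T_r)[T_(k+1)]; enlarging the  *)
(*   coefficient field as in uniF does not change its result.                 *)
(* - In (b), S_j is a semi-triangular system only if f_j involves T_(k+1);    *)
(*   otherwise a_j = 0, so that S_j would have the zero polynomial as last    *)
(*   component, and S_j is left out.                                          *)
Inductive split_step S (i : 'I_r) : seq system -> Prop :=
  | SplitDivide f h j a u of
      f \in sq S & (0 < degT i f)%N &
      h \in sq S `\ f & (0 < degT i h)%N & (degT i h <= degT i f)%N &
      uniF i a = FracField.tofrac (LC i h) ^+ j *: (uniF i f %/ uniF i h) &
      uniF i u = FracField.tofrac (LC i h) ^+ j *: (uniF i f %% uniF i h) :
      split_step S i
        [:: System (u |` (sq S `\ f)) (tri S) (lvl S) (LC i h * gpol S);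
            System (LC i h |` sq S) (tri S) (lvl S) (gpol S)]
  | SplitLead f of
      f \in sq S & (0 < degT i f)%N &
      {in sq S `\ f, forall h, degT i h = 0%N} :
      split_step S i
        (branch_last S i f ::
         [seq branch S i f j | j <- iota 1 (degT i f)
                             & (0 < degT i (head_part i f j.+1))%N])
  | SplitNone of {in sq S, forall f, degT i f = 0%N} :
      split_step S i [:: System (sq S) (tri S) (lvl S).+1 (gpol S)].

(* one iteration of the loop of MakeTriangular *)
Inductive MakeTriangular_step : seq system -> seq system -> Prop :=
  MakeTriangularStep M1 S M2 (i : 'I_r) R M of
    i = lvl S :> nat & is_red (sq S) R &
    split_step (System R (tri S) (lvl S) (gpol S)) i M :
    MakeTriangular_step (M1 ++ S :: M2) (M1 ++ M ++ M2).

(* The variables 'X_i with i \in V are kept as variables, the others become   *)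
(* elements of the field K('X_i | i \notin V); both kinds are renumbered in   *)
(* increasing order.                                                          *)
Definition fracfield (V : {set 'I_r}) := {fraction {mpoly F[#|~: V|]}}.

Definition embed_var (V : {set 'I_r}) i : {mpoly (fracfield V)[#|V|]} :=
  if [pick a : 'I_#|V| | enum_val a == i] is Some a then 'X_a
  else if [pick b : 'I_#|~: V| | enum_val b == i] is Some b then
    (FracField.tofrac 'X_b)%:MP
  else 0.

Definition embed (V : {set 'I_r}) f : {mpoly (fracfield V)[#|V|]} :=
  mmap (@mpolyC #|V| (fracfield V) \o @FracField.tofrac {mpoly F[#|~: V|]}
          \o @mpolyC #|~: V| F)
       (embed_var V) f.

Definition pivots G : {set 'I_r} := [set i | has (pivot^~ i) G].

End Polynomials.

Definition embed_system (F : fieldType) (r : nat) (S : system F r) :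
    system (fracfield F (pivots (tri S))) #|pivots (tri S)| :=
  let V := pivots (tri S) in
  System fset0 [fset embed V f | f in tri S] #|V| (embed V (gpol S)).

Section Algorithm.
Variables (K : fieldType) (r : nat).
Local Notation P := {mpoly K[r]}.

Definition has_nonzero_constant (G : {fset P}) : Prop :=
  exists2 c : K, c != 0 & c%:MP \in G.

(* IsSolvable S b: S is an admissible input, and b is returned *)
Inductive IsSolvable (S : system K r) : bool -> Prop :=
  | IsSolvableConst of triangular S & has_nonzero_constant (sq S) :
      IsSolvable S false
  | IsSolvableMonomial S' p n of
      triangular S & ~ has_nonzero_constant (sq S) &
      MakeMonic (embed_system S) S' &
      is_minpoly 0 (tri S') (gpol S') p & p = 'X^n :
      IsSolvable S false
  | IsSolvableOther S' p of
      triangular S & ~ has_nonzero_constant (sq S) &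
      MakeMonic (embed_system S) S' &
      is_minpoly 0 (tri S') (gpol S') p & (forall n, p <> 'X^n) :
      IsSolvable S true.

Inductive state :=
  | Triangulating of seq (system K r)
  | Testing of seq (system K r)
  | Returned of bool.

Inductive step : state -> state -> Prop :=
  | StepTriangular M M' of MakeTriangular_step M M' :
      step (Triangulating M) (Triangulating M')
  | StepTriangularDone M of all (fun S => ~~ (lvl S < r)%N) M :
      step (Triangulating M) (Testing M)
  | StepSolvable S M of IsSolvable S true :
      step (Testing (S :: M)) (Returned false)
  | StepUnsolvable S M of IsSolvable S false :
      step (Testing (S :: M)) (Testing M)
  | StepNil : step (Testing [::]) (Returned true).

(* Every execution from the given state, whatever the choices made, stops     *)
(* after finitely many steps, does not get stuck, and returns b.              *)
Inductive returns (b : bool) : state -> Prop :=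
  | ReturnsNow : returns b (Returned b)
  | ReturnsLater s of (exists s', step s s') &
      (forall s', step s s' -> returns b s') : returns b s.

Definition ContainsMonomial_returns (s : nat) (f : 'I_s -> P) (b : bool) :=
  returns b
    (Triangulating
       [:: System [fset f a | a : 'I_s] fset0 0 (\prod_(i < r) 'X_i)]).

End Algorithm.

(* Main.v *)
Require Import Defs.
From HB Require Import structures.
From Stdlib Require Import Relations Classical ClassicalEpsilon Wellfounded.
From Stdlib Require List.
From mathcomp Require Import all_boot all_order all_algebra.
From mathcomp Require Import fraction finmap.
From mathcomp Require Import mpoly.
From mathcomp Require Import ring.

Set Implicit Arguments.
Unset Strict Implicit.
Unset Printing Implicit Defensive.

Import GRing.Theory.
Local Open Scope fset_scope.
Local Open Scope ring_scope.

(** A system (F_sq, F_tri, k, g) stands for the locally closed set on which F_sq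
    and F_tri vanish and g does not. Since the field is arbitrary, its being empty
    is expressed by ideals: the system is [unsolvable] if a power of g lies in the
    ideal of F_sq and F_tri. For the first system, with g = T_1 ... T_r, this says
    that I contains a monomial. So the theorem follows from three facts.

    - A pass of the loop replaces a system by systems that are all unsolvable if
      and only if it is ([split_unsolvable]). Both cases (a) and (b) distinguish
      whether some coefficient b vanishes, and g is in the radical of J if and only
      if b g is and g is in the radical of J + (b) ([in_radical_split]). Where b is
      inverted, f may be replaced by its pseudo-remainder.

    - The loop ends ([wf_smaller], [split_smaller]). As long as the level k stays
      the same, let d be the sum of the degrees in T_(k+1) of the elements of F_sq.
      Reduction does not increase d, as the order is lexicographic and F_sq does not
      involve T_1, ..., T_k. The first system of (a) has smaller d. In the second
      one, b = LC(h) is added; LT(b) is a proper divisor of LT(h), so by reducedness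
      it is not in the ideal of the leading terms of F_sq, which thus grows. By
      Dickson's lemma this cannot go on forever. A step that replaces an element of
      a well-founded order by finitely many smaller ones is again well-founded
      ([wf_replace_step]); this covers both the list of systems and reduction.

    - IsSolvable answers whether the system is not unsolvable ([IsSolvable_sound]).
      Let L be the field of the rational functions in the free variables, those that
      are not pivots. Three ideals are compared, up to multiplication by powers of
      g: that of F_tri over K, its extension over L, and that of the monic family.
      If c is a nonzero polynomial in the free variables and c x is in the ideal of
      F_tri, then so is g^N x for some N ([free_variables_regular]): once the leading
      coefficients are inverted, each element of F_tri is monic in its pivot, and
      adjoining a root of it keeps c regular. Clearing denominators then gives the
      descent from L to K ([emb_in_radical]). A pass of MakeMonic multiplies f_n by
      an inverse of its leading coefficient h, up to powers of h ([pass_relation]).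
      Finally g^n lies in an ideal for some n if and only if the minimal polynomial
      of the class of g divides a power of X, that is, is itself one ([dvdp_Xn]).

    An execution never blocks: reductions exist by repeated lexicographic division
    ([red_exists]), one of the cases (a), (b), (c) always applies ([split_exists]),
    and modulo a monic family the quotient has finite dimension, which provides the
    minimal polynomials ([above_spanned], [minpoly_exists]). *)

(** * Well-founded relations, Dickson's lemma and the lexicographic order *)

Section WellFoundedness.

Lemma no_chain_wf (T : Type) (R : T -> T -> Prop) :
  (forall u : nat -> T, ~ forall n, R (u n.+1) (u n)) -> well_founded R.
Proof.
move=> nochain; apply: NNPP => nwf.
have [x nAx] : exists x, ~ Acc R x by exact: (@not_all_ex_not _ (Acc R) nwf).
have next (y : {y | ~ Acc R y}) : exists z : {y | ~ Acc R y}, R (sval z) (sval y).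
  case: y => y nAy /=; apply: NNPP => none; apply: nAy; constructor=> z Rzy.
  by apply: NNPP => nAz; apply: none; exists (exist _ z nAz).
pose nx y := sval (constructive_indefinite_description _ (next y)).
refine (nochain (fun n => sval (iter n nx (exist _ x nAx))) _) => n /=.
exact: (svalP (constructive_indefinite_description _ (next (iter n nx (exist _ x nAx))))).
Qed.

Lemma ex_nat_min (Q : nat -> Prop) :
  (exists n, Q n) -> exists2 n, Q n & forall m, Q m -> (n <= m)%N.
Proof.
case=> n; elim/ltn_ind: n => n IHn Qn.
case: (classic (exists2 m, (m < n)%N & Q m)) => [[m lt_mn Qm]|none].
  exact: (IHn m).
exists n => // m Qm; rewrite leqNgt; apply/negP => lt_mn.
by apply: none; exists m.
Qed.

Lemma monotone_subsequence (u : nat -> nat) :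
  exists2 phi : nat -> nat, {homo phi : a b / (a < b)%N}
    & {homo u \o phi : a b / (a <= b)%N}.
Proof.
(* mu n is an index at least n at which u takes its least value on [n, oo[ *)
have least n : exists m, (n <= m)%N /\ forall p, (n <= p)%N -> (u m <= u p)%N.
  have [|v [m le_nm <-] min_v] := @ex_nat_min (fun v => exists2 m, (n <= m)%N & u m = v).
    by exists (u n), n.
  by exists m; split=> // p le_np; apply: min_v; exists p.
pose mu n := sval (constructive_indefinite_description _ (least n)).
have [le_mu mu_min] : (forall n, (n <= mu n)%N) /\
    (forall n p, (n <= p)%N -> (u (mu n) <= u p)%N).
  by split=> n; case: (svalP (constructive_indefinite_description _ (least n))).
pose phi n := iter n (fun a => mu a.+1) (mu 0).
have phiS n : (phi n < phi n.+1)%N by exact: le_mu.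
have homo_phi : {homo phi : a b / (a < b)%N}.
  by apply: homo_ltn => // b a c; apply: ltn_trans.
exists phi => //; apply: homo_leq => //= [b a c|n]; first exact: leq_trans.
case: n => [|n] /=; apply: mu_min; first by rewrite leq0n.
by apply: leq_trans (le_mu _); apply: leqW; apply: le_mu.
Qed.

(** Extracting, for one coordinate after the other, a subsequence on which it is
    monotone leaves a subsequence that is monotone for divisibility. *)
Lemma dickson (r : nat) (u : nat -> 'X_{1..r}) :
  exists a b, (a < b)%N /\ (u a <= u b)%MM.
Proof.
suff [phi homo_phi homo_u] : exists2 phi : nat -> nat,
    {homo phi : a b / (a < b)%N} & forall i, i \in enum 'I_r ->
      {homo (fun n => u (phi n) i) : a b / (a <= b)%N}.
  exists (phi 0), (phi 1); split; first exact: homo_phi.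
  by apply/mnm_lepP => i; apply: homo_u; rewrite ?mem_enum.
elim: (enum _) => [|i s [phi homo_phi homo_u]]; first by exists id.
have [psi homo_psi homo_i] := monotone_subsequence (fun n => u (phi n) i).
exists (phi \o psi) => [a b /homo_psi /homo_phi //|j].
rewrite inE => /predU1P[-> //|js] a b le_ab; apply: homo_u => //.
by move: le_ab; rewrite leq_eqVlt => /predU1P[->//|/homo_psi/ltnW].
Qed.


Definition upset (r : nat) (A : 'X_{1..r} -> Prop) : Prop :=
  forall m m', (m <= m')%MM -> A m -> A m'.

(** Strict growth of monomial ideals, given by their sets of monomials: [A] is the
    larger one. *)
Definition grows (r : nat) (A B : 'X_{1..r} -> Prop) : Prop :=
  [/\ upset A, upset B, (forall m, B m -> A m) & exists2 m, A m & ~ B m].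

(** In an infinite ascending chain, monomials that are new at each step would
    contradict Dickson's lemma. *)
Lemma wf_grows r : well_founded (@grows r).
Proof.
apply: no_chain_wf => A gA.
have new n : exists m, A n.+1 m /\ ~ A n m by case: (gA n) => _ _ _ [m]; exists m.
pose m n := sval (constructive_indefinite_description _ (new n)).
have [Am nAm] : (forall n, A n.+1 (m n)) /\ (forall n, ~ A n (m n)).
  by split=> n; case: (svalP (constructive_indefinite_description _ (new n))).
have monoA d n p : A n p -> A (d + n)%N p.
  by elim: d => // d IHd /IHd; case: (gA (d + n)%N) => _ _ sub _; apply: sub.
have [a [b [lt_ab le_m]]] := dickson m; apply: (nAm b).
have [_ up _ _] := gA b; apply: (up _ _ le_m).
by rewrite -(subnK lt_ab); apply: monoA.
Qed.

Section LexicographicOrder.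
Variable r : nat.
Implicit Types (m : 'X_{1..r}) (i j : 'I_r).

Lemma lexltP m1 m2 :
  reflect (exists2 i, (m1 i < m2 i)%N & forall j, (j < i)%N -> m1 j = m2 j)
          (lexlt m1 m2).
Proof.
apply: (iffP existsP) => [[i /andP[lti /forallP eqj]]|[i lti eqj]]; exists i => //.
  by move=> j ltji; apply/eqP; apply: (implyP (eqj j)).
by rewrite lti; apply/forallP => j; apply/implyP => /eqj->.
Qed.

Lemma lexlt_irr m : lexlt m m = false.
Proof. by apply/lexltP => -[i]; rewrite ltnn. Qed.

Lemma lexlt_trans : transitive (@lexlt r).
Proof.
move=> m2 m1 m3 /lexltP[i lti eqi] /lexltP[j ltj eqj]; apply/lexltP.
case: (ltngtP i j) => [ltij|ltji|eqij].
- by exists i => [|k ltk]; rewrite -?(eqj i) // eqi // eqj // (ltn_trans ltk).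
- by exists j => [|k ltk]; rewrite eqi // ?eqj // (ltn_trans ltk).
- exists i => [|k ltk]; last by rewrite eqi // eqj // -eqij.
  by rewrite (ltn_trans lti) // (val_inj eqij).
Qed.

Lemma lexlt_total m1 m2 : m1 != m2 -> lexlt m1 m2 || lexlt m2 m1.
Proof.
move=> neq; have [i0 ne_i0] : exists i, m1 i != m2 i.
  by apply/existsP; apply: contraR neq; rewrite negb_exists => /forallP eqm;
    apply/eqP/mnmP => i; apply/eqP; move: (eqm i); rewrite negbK.
case: (@arg_minnP _ i0 (fun i => m1 i != m2 i) (@nat_of_ord r) ne_i0) => i ne_i min_i.
have eqj j : (j < i)%N -> m1 j = m2 j.
  by move=> ltji; apply/eqP; apply: contraLR ltji; rewrite -leqNgt; apply: min_i.
have eqj' j : (j < i)%N -> m2 j = m1 j by move/eqj.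
case: (ltngtP (m1 i) (m2 i)) ne_i => // lti _; apply/orP; [left|right];
  by apply/lexltP; exists i.
Qed.

Lemma lexleP m1 m2 : reflect (m1 = m2 \/ lexlt m1 m2) (lexle m1 m2).
Proof. by apply: (iffP orP) => -[/eqP|]; auto. Qed.

Lemma lexle_refl m : lexle m m.
Proof. by apply/lexleP; left. Qed.

Lemma lexle_trans : transitive (@lexle r).
Proof.
move=> m2 m1 m3 /lexleP[->//|lt12] /lexleP[<-|lt23]; apply/lexleP; right=> //.
exact: lexlt_trans lt23.
Qed.

Lemma lexle_ltF m1 m2 : lexle m1 m2 -> lexlt m2 m1 = false.
Proof.
case/lexleP=> [->|lt12]; first exact: lexlt_irr.
by apply/negbTE/negP => lt21; have := lexlt_trans lt12 lt21; rewrite lexlt_irr.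
Qed.

Lemma lexle_total m1 m2 : lexle m1 m2 || lexle m2 m1.
Proof.
have [->|/lexlt_total] := eqVneq m1 m2; first by rewrite lexle_refl.
by rewrite /lexle => /orP[]->; rewrite !orbT.
Qed.

Lemma lexle_add2l m m1 m2 : lexle m1 m2 -> lexle (m + m1)%MM (m + m2)%MM.
Proof.
case/lexleP=> [->|/lexltP[i lti eqi]]; first exact: lexle_refl.
apply/lexleP; right; apply/lexltP; exists i; rewrite ?mnmDE ?ltn_add2l //.
by move=> j ltji; rewrite !mnmDE eqi.
Qed.

Lemma lexlt_add2r m m1 m2 : lexlt m1 m2 -> lexlt (m1 + m)%MM (m2 + m)%MM.
Proof.
case/lexltP=> i lti eqi; apply/lexltP; exists i; rewrite ?mnmDE ?ltn_add2r //.
by move=> j ltji; rewrite !mnmDE eqi.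
Qed.

Lemma lem_lexle m1 m2 : (m1 <= m2)%MM -> lexle m1 m2.
Proof.
move=> /mnm_lepP le12; case/orP: (lexle_total m1 m2) => // /lexleP[->|].
  exact: lexle_refl.
by case/lexltP=> i; rewrite ltnNge le12.
Qed.

(** The lexicographic order extends divisibility, so a descending chain contradicts
    Dickson's lemma as well. *)
Lemma wf_lexlt : well_founded (fun m1 m2 => lexlt m1 m2).
Proof.
apply: no_chain_wf => u chain; have [a [b [lt_ab le_ab]]] := dickson u.
have := lexle_ltF (lem_lexle le_ab); suff -> : lexlt (u b) (u a) by [].
elim: b lt_ab {le_ab} => // b IHb; rewrite ltnS leq_eqVlt => /predU1P[->//|/IHb].
exact: lexlt_trans.
Qed.

End LexicographicOrder.

Section Multiset.
Variables (T : Type) (R : T -> T -> Prop).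

(** One step of the multiset order, on lists. *)
Inductive replace_step : seq T -> seq T -> Prop :=
  ReplaceStep s1 x s2 s of List.Forall (fun y => R y x) s :
    replace_step (s1 ++ s ++ s2) (s1 ++ x :: s2).

(** An element may be added in front of an accessible list, by induction on this
    element and then on the list. *)
Lemma wf_replace_step : well_founded R -> well_founded replace_step.
Proof.
move=> wfR; have acc_cons x : forall t, Acc replace_step t -> Acc replace_step (x :: t).
  elim/(well_founded_ind wfR): x => x IHx t; elim=> {}t acc_t IHt.
  constructor=> t' step_t'; move: {-1}(x :: t) (erefl (x :: t)) step_t' => t0 Et0 step.
  case: step Et0 => s1 y s2 s below.
  case: s1 => [|z s1] /= [Ex Et]; subst.
    elim: below => [|w s' Rwx _ IHs] /=; first by constructor.
    exact: IHx.
  by apply: IHt; constructor.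
elim=> [|x t]; last exact: acc_cons.
by constructor=> t; move Et0: [::] => t0 step; case: step Et0 => -[|y s1] ? ? ? _ Et0.
Qed.

End Multiset.
End WellFoundedness.

(** * Polynomials in one of the variables *)

(** [uni] is locked, and its companions are restated for the locked version,
    because comparing two of its instances by unfolding takes exponential time. *)
HB.lock Definition expand (F : fieldType) (r : nat) (i : 'I_r) (f : {mpoly F[r]})
  : {poly {mpoly F[r]}} := uni i f.

Definition vdeg (F : fieldType) (r : nat) (i : 'I_r) (f : {mpoly F[r]}) : nat :=
  (size (expand i f)).-1.
Definition vcoef (F : fieldType) (r : nat) (i : 'I_r) (l : nat) (f : {mpoly F[r]}) :=
  (expand i f)`_l.
Definition vlead (F : fieldType) (r : nat) (i : 'I_r) (f : {mpoly F[r]}) :=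
  lead_coef (expand i f).
Definition tailpoly (F : fieldType) (r : nat) (k : nat) (f : {mpoly F[r]}) : bool :=
  [forall j : 'I_r, (j < k)%N ==> (vdeg j f == 0)%N].

Section Unseal.
Variables (F : fieldType) (r : nat).

Lemma uni_expand : @uni F r = @expand F r.
Proof. by rewrite expand.unlock. Qed.

Lemma degT_vdeg : @degT F r = @vdeg F r.
Proof. by rewrite /degT uni_expand. Qed.

Lemma coefT_vcoef : @coefT F r = @vcoef F r.
Proof. by rewrite /coefT uni_expand. Qed.

Lemma LC_vlead : @LC F r = @vlead F r.
Proof. by rewrite /LC uni_expand. Qed.

Lemma polyfrom_tailpoly : @polyfrom F r = @tailpoly F r.
Proof. by rewrite /polyfrom degT_vdeg. Qed.

End Unseal.

Section Supports.
Variables (F : fieldType) (r : nat).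
Local Notation P := {mpoly F[r]}.
Implicit Types (p q f : P) (i j : 'I_r) (m : 'X_{1..r}).

(** The degree bounds, the subrings F[T_(k+1), ..., T_r] and the bounds on leading
    monomials are all conditions on the monomials that occur. *)
Definition supported (A : pred 'X_{1..r}) p : Prop := {in msupp p, forall m, A m}.

Lemma supportedP A p : supported A p <-> forall m, ~~ A m -> p@_m = 0.
Proof.
split=> [sA m nAm|sA m]; last first.
  by rewrite mcoeff_msupp; apply: contraR => /sA->.
by apply/eqP; rewrite mcoeff_eq0; apply: contraNN nAm; apply: sA.
Qed.

Lemma supported0 A : supported A 0.
Proof. by apply/supportedP => m _; rewrite mcoeff0. Qed.

Lemma supportedD A p q : supported A p -> supported A q -> supported A (p + q).
Proof.
move=> /supportedP sp /supportedP sq; apply/supportedP => m nAm.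
by rewrite mcoeffD sp ?sq ?addr0.
Qed.

Lemma supportedZ A c p : supported A p -> supported A (c *: p).
Proof.
by move=> /supportedP sp; apply/supportedP => m nAm; rewrite mcoeffZ sp ?mulr0.
Qed.

Lemma supportedN A p : supported A p -> supported A (- p).
Proof. by rewrite -scaleN1r; apply: supportedZ. Qed.

Lemma supportedB A p q : supported A p -> supported A q -> supported A (p - q).
Proof. by move=> sp sq; apply: supportedD => //; apply: supportedN. Qed.

Lemma supported_sum A (I : eqType) (s : seq I) (E : I -> P) :
  {in s, forall x, supported A (E x)} -> supported A (\sum_(x <- s) E x).
Proof.
move=> sE; rewrite big_seq; elim/big_ind: _ => // [|p q]; first exact: supported0.
exact: supportedD.
Qed.

Lemma supportedM (A B C : pred 'X_{1..r}) p q :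
  (forall m1 m2, A m1 -> B m2 -> C (m1 + m2)%MM) ->
  supported A p -> supported B q -> supported C (p * q).
Proof.
move=> AB sp sq m /msuppM_le /allpairsP[[m1 m2] /= [m1p m2q ->]].
by apply: AB; [apply: sp|apply: sq].
Qed.

Lemma supportedX (A : pred 'X_{1..r}) m : A m -> supported A 'X_[m].
Proof. by move=> Am m'; rewrite msuppX inE => /eqP->. Qed.

Lemma supportedC (A : pred 'X_{1..r}) c : A 0%MM -> supported A c%:MP.
Proof. by move=> A0 m; rewrite msuppC; case: eqP => // _; rewrite inE => /eqP->. Qed.

Lemma supported_sub (A B : pred 'X_{1..r}) p :
  (forall m, A m -> B m) -> supported A p -> supported B p.
Proof. by move=> sAB sp m /sp/sAB. Qed.

Lemma lexleadP p : p != 0 ->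
  lexlead p \in msupp p /\ supported (fun m => lexle m (lexlead p)) p.
Proof.
rewrite -msupp_eq0 /lexlead /supported; elim: (msupp p) => // m s IHs _.
rewrite big_cons; case: s IHs => [|m' s] IHs.
  rewrite big_nil; have -> : lexlt m 0 = false.
    by apply/lexltP => -[i]; rewrite mnm0E.
  by rewrite inE eqxx; split=> // m1; rewrite inE => /eqP->; apply: lexle_refl.
have [{IHs} + max_s] := IHs isT; set M := \big[_/_]_(_ <- _) _ => Ms.
case: ifP => lt_mM; split; rewrite ?inE ?eqxx ?orbT //.
- by rewrite inE in Ms; rewrite Ms orbT.
- move=> m1; rewrite inE => /predU1P[->|/max_s//].
  by apply/lexleP; right.
- move=> m1; rewrite inE => /predU1P[->|/max_s le1]; first exact: lexle_refl.
  apply: (lexle_trans le1); case/orP: (lexle_total m M) => // /lexleP[->|].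
    exact: lexle_refl.
  by rewrite lt_mM.
Qed.

Lemma lexlead_le p m : p != 0 -> supported (fun m' => lexle m' m) p -> lexle (lexlead p) m.
Proof. by move=> /lexleadP[lead_p _] sp; apply: sp. Qed.

Lemma expandE i f : expand i f =
  \sum_(m <- msupp f)
    ((f@_m)%:MP * 'X_[[multinom (if j == i then 0 else m j)%N | j < r]])%:P * 'X^(m i).
Proof.
rewrite expand.unlock /uni /mmap; apply: eq_bigr => m _; rewrite polyCM -mulrA; congr (_ * _).
rewrite /mmap1 (bigD1 i) //= eqxx mulrC; congr (_ * _).
rewrite mpolyXE_id [in RHS](bigD1 i) //= mnmE eqxx expr0 mul1r rmorph_prod.
by apply: eq_bigr => j /negbTE neq_ji; rewrite neq_ji mnmE neq_ji rmorphXn.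
Qed.

(** All that follows about coefficients, degrees and leading coefficients in T_i is
    read off from this formula. *)
Lemma mcoeff_vcoef i l f m :
  (vcoef i l f)@_m = if m i == 0%N then f@_(m + U_(i) *+ l)%MM else 0.
Proof.
rewrite /vcoef expandE coef_sum raddf_sum /=.
pose E m' := f@_m' * ((m i == 0%N) && (m' == m + U_(i) *+ l)%MM)%:R.
transitivity (\sum_(m' <- msupp f) E m').
  apply: eq_bigr => m' _; rewrite coefCM coefXn mulr_natr mcoeffMn mcoeffCM mcoeffX.
  rewrite -mulrnAr -mulrnA mulnb /E; congr (_ * _%:R); congr nat_of_bool.
  apply/andP/andP => [[/eqP<- /eqP->]|[/eqP m_i /eqP->]].
    rewrite mnmE eqxx; split=> //; apply/eqP/mnmP => j.
    rewrite mnmDE mulmnE mnm1E mnmE eq_sym.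
    by case: (eqVneq i j) => [->|_]; rewrite ?mul1n ?mul0n ?addn0.
  rewrite mnmDE mulmnE mnm1E eqxx mul1n m_i add0n; split=> //.
  apply/eqP/mnmP => j; rewrite mnmE mnmDE mulmnE mnm1E eq_sym.
  by case: (eqVneq i j) => [<-|_]; rewrite ?mul0n ?addn0.
rewrite {}/E; case: eqP => _ /=; last by rewrite big1 // => m' _; rewrite mulr0.
rewrite [in RHS](mpolyE f) raddf_sum /=.
by apply: eq_bigr => m' _; rewrite mcoeffZ mcoeffX.
Qed.

Fact expand_zmod_morphism i : zmod_morphism (@expand F r i).
Proof. by rewrite -uni_expand => p q; apply: mmapB. Qed.

Fact expand_monoid_morphism i : monoid_morphism (@expand F r i).
Proof. by rewrite -uni_expand; split=> [|p q]; [apply: rmorph1|apply: rmorphM]. Qed.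

HB.instance Definition _ i :=
  GRing.isZmodMorphism.Build P {poly P} (@expand F r i) (expand_zmod_morphism i).
HB.instance Definition _ i :=
  GRing.isMonoidMorphism.Build P {poly P} (@expand F r i) (expand_monoid_morphism i).

Lemma expandD i p q : expand i (p + q) = expand i p + expand i q.
Proof. exact: rmorphD. Qed.

Lemma expandB i p q : expand i (p - q) = expand i p - expand i q.
Proof. exact: rmorphB. Qed.

Lemma expandM i p q : expand i (p * q) = expand i p * expand i q.
Proof. exact: rmorphM. Qed.

Lemma expandXn i p n : expand i (p ^+ n) = expand i p ^+ n.
Proof. exact: rmorphXn. Qed.

Lemma expandX i j : expand i ('X_j : P) = if j == i then 'X else ('X_j)%:P.
Proof. by rewrite expand.unlock /uni mmapX mmap1U. Qed.

Lemma expandC i (c : F) : expand i (c%:MP : P) = (c%:MP)%:P.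
Proof. by rewrite expand.unlock /uni mmapC. Qed.

(** [expand i] is thus injective, and an identity may be checked after expansion. *)
Lemma expandK i f : (expand i f).['X_i] = f.
Proof.
rewrite expandE horner_sum [RHS]mpolyE; apply: eq_bigr => m _.
rewrite hornerM hornerC hornerXn -mulrA mul_mpolyC; congr (_ *: _).
rewrite mpolyXn -mpolyXD; congr 'X_[_]; apply/mnmP => j.
rewrite mnmDE mulmnE mnm1E mnmE eq_sym.
by case: eqVneq => [<-|_]; rewrite ?mul1n // addn0.
Qed.

Lemma expand_inj i : injective (@expand F r i).
Proof. by apply: (can_inj (g := horner^~ 'X_i)) => f; apply: expandK. Qed.

Lemma expand_eq0 i f : (expand i f == 0) = (f == 0).
Proof. by rewrite -(inj_eq (@expand_inj i)) rmorph0. Qed.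

Lemma size_expand_leP i f d :
  (size (expand i f) <= d)%N <-> supported (fun m => m i < d)%N f.
Proof.
split=> [/leq_sizeP sz m mf|sf]; last first.
  apply/leq_sizeP => l le_dl; apply/mpolyP => m; rewrite mcoeff0.
  have := mcoeff_vcoef i l f m; rewrite /vcoef => ->; case: eqP => // m_i.
  apply: (proj1 (supportedP _ _) sf).
  by rewrite mnmDE mulmnE mnm1E eqxx mul1n m_i add0n -leqNgt.
rewrite ltnNge; apply/negP => /sz coef0; move: mf; rewrite mcoeff_msupp.
pose m' := (m - U_(i) *+ m i)%MM.
have Em : m = (m' + U_(i) *+ m i)%MM.
  apply/mnmP => j; rewrite mnmDE mnmBE mulmnE mnm1E eq_sym.
  by case: eqVneq => [<-|_]; rewrite ?mul1n ?subnK // mul0n subn0 addn0.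
have m'i : m' i = 0%N by rewrite mnmBE mulmnE mnm1E eqxx mul1n subnn.
have := mcoeff_vcoef i (m i) f m'.
by rewrite m'i eqxx -Em /vcoef coef0 mcoeff0 => <-; rewrite eqxx.
Qed.

Lemma vdeg_leP i f d : (vdeg i f <= d)%N <-> supported (fun m => m i <= d)%N f.
Proof.
have -> : (vdeg i f <= d)%N = (size (expand i f) <= d.+1)%N.
  by rewrite /vdeg; case: (size _).
exact: size_expand_leP.
Qed.

Lemma vdeg_lt_size i f d : (0 < d)%N -> (size (expand i f) <= d)%N -> (vdeg i f < d)%N.
Proof. by rewrite /vdeg; case: (size _). Qed.

Lemma size_expand i f : f != 0 -> size (expand i f) = (vdeg i f).+1.
Proof. by move=> nz_f; rewrite /vdeg prednK // size_poly_gt0 expand_eq0. Qed.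

Lemma size_expand_le i f : (size (expand i f) <= (vdeg i f).+1)%N.
Proof. exact: leqSpred. Qed.

Lemma vdeg0P i f : vdeg i f = 0%N <-> supported (fun m => m i == 0)%N f.
Proof.
have := vdeg_leP i f 0; rewrite leqn0 => E.
split=> [d0|s0]; first by apply: (supported_sub _ (proj1 E _)) => [m|]; rewrite ?leqn0 ?d0.
by apply/eqP/E; apply: supported_sub s0 => m /eqP->.
Qed.

Lemma expand_free i f : vdeg i f = 0%N -> expand i f = f%:P.
Proof.
move=> d0; have sz1 : (size (expand i f) <= 1)%N.
  by move: d0; rewrite /vdeg; case: size => [|[]].
by rewrite -{2}(expandK i f) (size1_polyC sz1) hornerC.
Qed.

Lemma vcoef_supported (A B : pred 'X_{1..r}) i l f :
  (forall m, m i = 0%N -> A (m + U_(i) *+ l)%MM -> B m) ->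
  supported A f -> supported B (vcoef i l f).
Proof.
move=> AB /supportedP sf; apply/supportedP => m nBm.
rewrite mcoeff_vcoef; case: eqP => // m_i; apply: sf.
by apply: contraNN nBm; apply: AB.
Qed.

Lemma vcoef_free i l f : supported (fun m => m i == 0)%N (vcoef i l f).
Proof. by apply: (@vcoef_supported xpredT) => // m ->. Qed.

Lemma tailpolyP k f : tailpoly k f <->
  supported (fun m => [forall j : 'I_r, (j < k)%N ==> (m j == 0)%N]) f.
Proof.
split=> [/forallP pf m mf|sf]; [apply/forallP => j|apply/forallP => j].
  apply/implyP => ltjk; have /eqP/vdeg0P := implyP (pf j) ltjk; exact.
apply/implyP => ltjk; apply/eqP/vdeg0P; apply: supported_sub sf => m /forallP/(_ j).
by rewrite ltjk.
Qed.

Lemma tailpoly0 f : tailpoly 0 f.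
Proof. by apply/forallP. Qed.

Lemma tailpolyB k f g : tailpoly k f -> tailpoly k g -> tailpoly k (f - g).
Proof.
by move=> /tailpolyP sf /tailpolyP sg; apply/tailpolyP; apply: supportedB.
Qed.

Lemma tailpolyD k f g : tailpoly k f -> tailpoly k g -> tailpoly k (f + g).
Proof.
by move=> /tailpolyP sf /tailpolyP sg; apply/tailpolyP; apply: supportedD.
Qed.

Lemma tailpolyM k f g : tailpoly k f -> tailpoly k g -> tailpoly k (f * g).
Proof.
move=> /tailpolyP sf /tailpolyP sg; apply/tailpolyP; apply: supportedM sf sg.
move=> m1 m2 /forallP s1 /forallP s2; apply/forallP => j; apply/implyP => ltjk.
by rewrite mnmDE (eqP (implyP (s1 j) ltjk)) (eqP (implyP (s2 j) ltjk)).
Qed.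

Lemma tailpolyC k c : tailpoly k (c%:MP : P).
Proof.
by apply/tailpolyP/supportedC/forallP => j; rewrite mnm0E eqxx implybT.
Qed.

Lemma tailpoly_zero k : tailpoly k (0 : P).
Proof. by rewrite -mpolyC0 tailpolyC. Qed.

Lemma tailpoly1 k : tailpoly k (1 : P).
Proof. by rewrite -mpolyC1 tailpolyC. Qed.

Lemma tailpolyXn k f n : tailpoly k f -> tailpoly k (f ^+ n).
Proof.
move=> kf; elim: n => [|n IHn]; first by rewrite expr0 tailpoly1.
by rewrite exprS; apply: tailpolyM.
Qed.

Lemma tailpolyZ k c f : tailpoly k f -> tailpoly k (c *: f).
Proof. by move=> kf; rewrite -mul_mpolyC tailpolyM ?tailpolyC. Qed.

Lemma tailpolyXU k i : (k <= i)%N -> tailpoly k ('X_i : P).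
Proof.
move=> le_ki; apply/tailpolyP/supportedX/forallP => j; apply/implyP => ltjk.
by rewrite mnm1E; case: (eqVneq i j) ltjk => // <-; rewrite ltnNge le_ki.
Qed.

Lemma tailpoly_leq k l f : (k <= l)%N -> tailpoly l f -> tailpoly k f.
Proof.
move=> le_kl /forallP pf; apply/forallP => j; apply/implyP => ltjk.
exact: implyP (pf j) (leq_trans ltjk le_kl).
Qed.

Lemma tailpoly_free k i f : (i < k)%N -> tailpoly k f -> vdeg i f = 0%N.
Proof. by move=> ltik /forallP/(_ i); rewrite ltik => /eqP. Qed.

Lemma tailpolyS i f : tailpoly i.+1 f = tailpoly i f && (vdeg i f == 0%N).
Proof.
apply/idP/andP => [pf|[/forallP pf d0]].
  by rewrite (tailpoly_leq _ pf) // (tailpoly_free _ pf).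
apply/forallP => j; apply/implyP; rewrite ltnS leq_eqVlt => /orP[/eqP/val_inj->//|].
exact/implyP.
Qed.

Lemma tailpoly_vcoef k i l f : tailpoly k f -> tailpoly k (vcoef i l f).
Proof.
move=> /tailpolyP sf; apply/tailpolyP; apply: vcoef_supported sf => m _ /forallP s0.
apply/forallP => j; apply/implyP => ltjk; move/implyP/(_ ltjk): (s0 j).
by rewrite mnmDE addn_eq0 => /andP[].
Qed.

Lemma tailpolyS_vcoef i l f : tailpoly i f -> tailpoly i.+1 (vcoef i l f).
Proof.
move=> pf; rewrite tailpolyS tailpoly_vcoef //=; apply/eqP/vdeg0P; exact: vcoef_free.
Qed.

Lemma pivotP f i : pivot f i <-> tailpoly i f /\ (0 < vdeg i f)%N.
Proof.
rewrite /pivot polyfrom_tailpoly tailpolyS negb_and lt0n.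
by split=> [/andP[->]//|[-> ->]]; rewrite orbT.
Qed.

Lemma pivot_inj f i j : pivot f i -> pivot f j -> i = j.
Proof.
suff lt_absurd a b : pivot f a -> pivot f b -> ~ (a < b)%N.
  move=> pi pj; apply/val_inj; case: (ltngtP i j) => // lt_ij.
    by case: (lt_absurd _ _ pi pj).
  by case: (lt_absurd _ _ pj pi).
by move=> /pivotP[_ da] /pivotP[pb _] ltab; rewrite (tailpoly_free ltab pb) in da.
Qed.

Lemma vleadE i f : vlead i f = vcoef i (vdeg i f) f.
Proof. by []. Qed.

Lemma vlead_eq0 i f : (vlead i f == 0) = (f == 0).
Proof. by rewrite /vlead lead_coef_eq0 expand_eq0. Qed.

Lemma vcoef_sum i f n : (vdeg i f < n)%N -> f = \sum_(l < n) vcoef i l f * 'X_i ^+ l.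
Proof.
move=> lt_dn; rewrite -[LHS](expandK i) (@horner_coef_wide _ n) //.
by apply: leq_trans lt_dn; apply: leqSpred.
Qed.

End Supports.

(** * Ideals and membership in their radicals *)

Section Ideals.
Variables (F : fieldType) (r : nat).
Local Notation P := {mpoly F[r]}.
Implicit Types (p q f g b c : P) (G H : {fset P}) (k : nat).

Lemma ideal_from_gen k G g : g \in G -> ideal_from k G g.
Proof.
move=> Gg; rewrite /ideal_from polyfrom_tailpoly.
exists (fun x => (x == g)%:R) => [x _|].
  by case: (x == g); [apply: tailpoly1|apply: tailpoly_zero].
rewrite (bigD1_seq g) ?fset_uniq //= eqxx mul1r big1 ?addr0 // => x /negbTE->.
by rewrite mul0r.
Qed.

Lemma ideal_fromMl k G c p : tailpoly k c -> ideal_from k G p -> ideal_from k G (c * p).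
Proof.
rewrite /ideal_from polyfrom_tailpoly.
move=> kc [d kd ->]; exists (fun g => c * d g) => [g Gg|].
  by apply: tailpolyM => //; apply: kd.
by rewrite mulr_sumr; apply: eq_bigr => g _; rewrite mulrA.
Qed.

Lemma ideal_from0 k G : ideal_from k G 0.
Proof.
rewrite /ideal_from polyfrom_tailpoly; exists (fun=> 0) => [g _|].
  exact: tailpoly_zero.
by rewrite big1 // => g _; rewrite mul0r.
Qed.

Lemma ideal_fromD k G p q : ideal_from k G p -> ideal_from k G q -> ideal_from k G (p + q).
Proof.
rewrite /ideal_from polyfrom_tailpoly.
move=> [c kc ->] [d kd ->]; exists (fun g => c g + d g) => [g Gg|].
  by apply: tailpolyD; [apply: kc|apply: kd].
by rewrite -big_split; apply: eq_bigr => g _; rewrite mulrDl.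
Qed.

Lemma ideal_fromB k G p q : ideal_from k G p -> ideal_from k G q -> ideal_from k G (p - q).
Proof.
move=> Gp Gq; apply: ideal_fromD => //; rewrite -mulN1r; apply: ideal_fromMl => //.
by rewrite -mpolyC1 -mpolyCN tailpolyC.
Qed.

Lemma ideal_from_ind k G (Q : P -> Prop) :
  Q 0 -> (forall p q, Q p -> Q q -> Q (p + q)) ->
  (forall c g, tailpoly k c -> g \in G -> Q (c * g)) ->
  forall p, ideal_from k G p -> Q p.
Proof.
rewrite /ideal_from polyfrom_tailpoly => Q0 QD QM p [c kc ->].
rewrite big_seq; elim/big_ind: _ => // g Gg.
by apply: QM => //; apply: kc.
Qed.

Lemma ideal_from_sub k l G H p : (l <= k)%N ->
  (forall g, g \in G -> ideal_from l H g) -> ideal_from k G p -> ideal_from l H p.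
Proof.
move=> le_lk sGH; move: p; apply: ideal_from_ind => [|p q|c g kc /sGH].
  exact: ideal_from0.
  exact: ideal_fromD.
by move=> lg; apply: ideal_fromMl lg; apply: tailpoly_leq le_lk kc.
Qed.

Lemma ideal_gen G g : g \in G -> ideal G g.
Proof. exact: ideal_from_gen. Qed.

Lemma idealMl G c p : ideal G p -> ideal G (c * p).
Proof. by apply: ideal_fromMl; apply: tailpoly0. Qed.

Lemma ideal_sub G H p : (forall g, g \in G -> ideal H g) -> ideal G p -> ideal H p.
Proof. exact: (@ideal_from_sub 0 0). Qed.

Lemma ideal_subset G H p : {subset G <= H} -> ideal G p -> ideal H p.
Proof. by move=> sGH; apply: ideal_sub => g /sGH; apply: ideal_gen. Qed.

Lemma ideal_fsetU1 G b p : ideal (b |` G) p <-> exists c, ideal G (p - c * b).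
Proof.
split=> [|[c Gp]].
  move: p; apply: ideal_from_ind => [|p q [c Gp] [d Gq]|c g _].
  - by exists 0; rewrite mul0r subr0; apply: ideal_from0.
  - by exists (c + d); rewrite mulrDl opprD addrACA; apply: ideal_fromD Gp Gq.
  - rewrite !inE => /predU1P[->|Gg]; first by exists c; rewrite subrr; apply: ideal_from0.
    by exists 0; rewrite mul0r subr0; apply/idealMl/ideal_gen.
rewrite -[p](subrK (c * b)); apply: ideal_fromD.
  by apply: ideal_subset Gp => g Gg; rewrite !inE Gg orbT.
by apply/idealMl/ideal_gen; rewrite !inE eqxx.
Qed.

Definition in_radical G p : Prop := exists n, ideal G (p ^+ n).

(** It is enough to check on generators that a power of g moves an ideal into
    another one. *)
Lemma ideal_saturation G H g :
  (forall f, f \in G -> exists n, ideal H (g ^+ n * f)) ->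
  forall p, ideal G p -> exists n, ideal H (g ^+ n * p).
Proof.
move=> sGH p; move: p; apply: ideal_from_ind => [|p q [n Hp] [l Hq]|c f _ /sGH[n Hf]].
- by exists 0%N; rewrite mulr0; apply: ideal_from0.
- exists (n + l)%N; rewrite mulrDr; apply: ideal_fromD.
    by rewrite addnC exprD -mulrA; apply: idealMl.
  by rewrite exprD -mulrA; apply: idealMl.
- by exists n; rewrite mulrCA; apply: idealMl.
Qed.

Lemma in_radical_transfer G H g :
  (forall f, f \in G -> exists n, ideal H (g ^+ n * f)) -> in_radical G g -> in_radical H g.
Proof.
move=> sGH [n /(ideal_saturation sGH)[l]]; rewrite -exprD => Hg.
by exists (l + n)%N.
Qed.

Lemma in_radical_sub G H g :
  (forall p, ideal G p -> ideal H p) -> in_radical G g -> in_radical H g.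
Proof. by move=> sGH [n /sGH Hg]; exists n. Qed.

(** The vanishing of g on a set may be checked separately where b is nonzero and
    where b is zero. If (b g)^n is in J and g^l = c b modulo J, then g^(n + l n) is
    congruent to g^n c^n b^n modulo J. *)
Lemma in_radical_split G b g :
  in_radical G g <-> in_radical G (b * g) /\ in_radical (b |` G) g.
Proof.
split=> [[n Gg]|[[n Gbg] [l /ideal_fsetU1[c Gl]]]].
  split; exists n; first by rewrite exprMn; apply: idealMl.
  by apply: ideal_subset Gg => p Gp; rewrite !inE Gp orbT.
exists (n + l * n)%N; rewrite exprD exprM.
have -> : g ^+ n * (g ^+ l) ^+ n =
    g ^+ n * ((g ^+ l) ^+ n - (c * b) ^+ n) + c ^+ n * (b * g) ^+ n.
  by rewrite mulrBr !exprMn [c ^+ n * (_ * _)]mulrA [_ * g ^+ n]mulrC subrK.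
apply: ideal_fromD; last exact: idealMl.
by rewrite subrXX mulrCA mulrC; apply: idealMl.
Qed.

End Ideals.

(** * Lexicographic division and reduction *)

Section Reduction.
Variables (F : fieldType) (r : nat).
Local Notation P := {mpoly F[r]}.
Implicit Types (p q f g b c u : P) (G H R : {fset P}) (k : nat) (i j : 'I_r).
Implicit Types m : 'X_{1..r}.

Definition lex_bounded m p : Prop := supported (fun m' => lexle m' m) p.

Lemma lexlead0 : lexlead (0 : P) = 0%MM.
Proof. by rewrite /lexlead msupp0 big_nil. Qed.

Lemma lex_bounded_lead p : lex_bounded (lexlead p) p.
Proof.
by have [->|/lexleadP[]//] := eqVneq p 0; apply: supported0.
Qed.

Arguments lex_bounded_lead : clear implicits.

Lemma lex_bounded_le m m' p : lexle m m' -> lex_bounded m p -> lex_bounded m' p.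
Proof. by move=> le_mm'; apply: supported_sub => a le_am; apply: lexle_trans le_mm'. Qed.

Lemma lex_bounded_term m n p (c : F) : (lexlead p + n)%MM = m -> lex_bounded m (c *: 'X_[n] * p).
Proof.
move=> <-; apply: (@supportedM _ _ (pred1 n) (fun m => lexle m (lexlead p))).
- by move=> m1 m2 /eqP->; rewrite (addmC (lexlead p)); apply: lexle_add2l.
- by apply/supportedZ/supportedX; rewrite /= eqxx.
- exact: lex_bounded_lead.
Qed.

Lemma lexlead_lt m p : p != 0 -> lex_bounded m p -> p@_m = 0 -> lexlt (lexlead p) m.
Proof.
move=> nz_p bp pm0; have [lead_p _] := lexleadP nz_p.
case/lexleP: (bp _ lead_p) => // Em.
by move: lead_p; rewrite Em mcoeff_msupp pm0 eqxx.
Qed.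

Definition normal_wrt G u : Prop :=
  {in msupp u, forall m, {in G, forall g, g != 0 -> ~~ (lexlead g <= m)%MM}}.

(** Division of f by G in which no term exceeds the monomial m. *)
Definition divisible_within G m f : Prop :=
  exists (q : P -> P) u, [/\ f = \sum_(g <- G) q g * g + u,
    {in G, forall g, lex_bounded m (q g * g)}, lex_bounded m u & normal_wrt G u].

(** Usual division algorithm, by induction on m: the term of f at m is cancelled
    by an element of G if possible, and goes to the remainder otherwise. *)
Lemma lex_division G m f : lex_bounded m f -> divisible_within G m f.
Proof.
elim/(well_founded_ind (@wf_lexlt r)): m f => m IHm.
have below f : lex_bounded m f -> f@_m = 0 -> divisible_within G m f.
  move=> bf fm0; have [->|nz_f] := eqVneq f 0.
    exists (fun=> 0), 0; split=> [|g _||m'].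
    - by rewrite addr0 big1 // => g _; rewrite mul0r.
    - by rewrite mul0r; apply: supported0.
    - exact: supported0.
    - by rewrite msupp0.
  have lt_fm := lexlead_lt nz_f bf fm0.
  have [q [u [Ef bq bu nu]]] := IHm _ lt_fm _ (lex_bounded_lead f).
  have le_fm : lexle (lexlead f) m by apply/lexleP; right.
  exists q, u; split=> // [g Gg|]; apply: lex_bounded_le le_fm _ => //.
  exact: (bq g).
move=> f bf; have [fm0|nz_fm] := eqVneq f@_m 0; first exact: below.
(* n and t are the monomial and the term by which g is multiplied. *)
case: (classic (exists2 g, g \in G & g != 0 /\ (lexlead g <= m)%MM)).
  case=> g Gg [nz_g le_gm]; pose n := (m - lexlead g)%MM.
  have En : (lexlead g + n)%MM = m by rewrite addmC submK.
  pose t := (f@_m / g@_(lexlead g)) *: 'X_[n].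
  have [lead_g _] := lexleadP nz_g; rewrite mcoeff_msupp in lead_g.
  have tgm : (t * g)@_m = f@_m.
    have -> : t * g = (f@_m / g@_(lexlead g)) *: (g * 'X_[n]) by rewrite (mulrC g) scalerAl.
    by rewrite mcoeffZ -{2}En addmC mcoeffMX divfK.
  have bt : lex_bounded m (t * g) by apply: lex_bounded_term.
  have [||q [u [Ef bq bu nu]]] := below (f - t * g).
  - exact: supportedB.
  - by rewrite mcoeffB tgm subrr.
  exists (fun x => q x + (x == g)%:R * t), u; split=> //.
    rewrite -[LHS](subrK (t * g)) Ef addrAC; congr (_ + _).
    under [RHS]eq_bigr => x _ do rewrite mulrDl.
    rewrite big_split /=; congr (_ + _); rewrite (bigD1_seq g) ?fset_uniq //= eqxx mul1r.
    by rewrite big1 ?addr0 // => x /negbTE->; rewrite !mul0r.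
  move=> x Gx; rewrite mulrDl; apply: supportedD; first exact: bq.
  by case: eqP => [->|_]; rewrite ?mul1r // mul0r mul0r; apply: supported0.
move=> irred; pose t := f@_m *: 'X_[m] : P.
have bt : lex_bounded m t by apply/supportedZ/supportedX; apply: lexle_refl.
have [||q [u [Ef bq bu nu]]] := below (f - t).
- exact: supportedB.
- by rewrite mcoeffB mcoeffZ mcoeffX eqxx mulr1 subrr.
exists q, (u + t); split=> //; first by rewrite addrA -Ef subrK.
  exact: supportedD.
move=> m' /msuppD_le; rewrite mem_cat => /orP[/nu//|/msuppZ_le].
rewrite msuppX inE => /eqP-> g Gg nz_g; apply/negP => le_gm.
by apply: irred; exists g.
Qed.

Lemma remainder_exists f G : exists u, remainder f G u.
Proof.
have [q [u [Ef bq _ nu]]] := lex_division G (lex_bounded_lead f).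
exists u, q; split=> // g Gg nz_qg; exact: (lexlead_le nz_qg (bq g Gg)).
Qed.

Lemma remainder_bounded f G u : remainder f G u -> lex_bounded (lexlead f) u.
Proof.
case=> q [Ef bq _].
have -> : u = f - \sum_(g <- G) q g * g by rewrite {1}Ef addrC addKr.
apply: supportedB; first exact: lex_bounded_lead.
apply: supported_sum => g Gg; have [->|nz] := eqVneq (q g * g) 0; first exact: supported0.
by apply: lex_bounded_le (lex_bounded_lead (q g * g)); apply: (bq g).
Qed.

(** On polynomials without T_1, ..., T_k, the lexicographic order compares the
    degrees in T_(k+1) first. *)
Lemma lexle_tail k m m' : lexle m m' ->
  (forall j, (j < k)%N -> m' j = 0%N) ->
  (forall j, (j < k)%N -> m j = 0%N) /\ (forall i, (i <= k)%N -> (m i <= m' i)%N).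
Proof.
case/lexleP=> [->|/lexltP[i0 lt0 eq0]] z; first by split.
have le_k_i0 : (k <= i0)%N.
  by rewrite leqNgt; apply/negP => /z z0; rewrite z0 in lt0.
split=> [j ltjk|i le_ik]; first by rewrite eq0 ?z // (leq_trans ltjk).
move: (leq_trans le_ik le_k_i0); rewrite leq_eqVlt => /orP[/eqP/val_inj->|/eq0->//].
exact: ltnW.
Qed.

Lemma tailpoly_lexlead k f : tailpoly k f -> forall j, (j < k)%N -> lexlead f j = 0%N.
Proof.
move=> /tailpolyP kf j ltjk; have [->|/lexleadP[/kf /forallP/(_ j)]] := eqVneq f 0.
  by rewrite lexlead0 mnm0E.
by rewrite ltjk => /eqP.
Qed.

(** This is where the order has to be lexicographic: a division that does not
    raise the leading monomial does not raise the degree in T_(i+1) either. *)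
Lemma vdeg_lexlead i f : tailpoly i f -> vdeg i f = lexlead f i.
Proof.
move=> kf; have z := tailpoly_lexlead kf; apply/eqP; rewrite eqn_leq; apply/andP; split.
  apply/vdeg_leP; apply: supported_sub (lex_bounded_lead f) => m le_m.
  by have [_] := lexle_tail le_m z; apply.
have [->|/lexleadP[lead_f _]] := eqVneq f 0; first by rewrite lexlead0 mnm0E.
by have /vdeg_leP := leqnn (vdeg i f); apply.
Qed.

Lemma lex_bounded_tailpoly k f u : tailpoly k f -> lex_bounded (lexlead f) u -> tailpoly k u.
Proof.
move=> kf bu; apply/tailpolyP => m /bu /lexle_tail/(_ (tailpoly_lexlead kf))[z _].
by apply/forallP => j; apply/implyP => /z->.
Qed.

Lemma lex_bounded_vdeg i f u : tailpoly i f -> lex_bounded (lexlead f) u ->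
  (vdeg i u <= vdeg i f)%N.
Proof.
move=> kf bu; rewrite (vdeg_lexlead kf); apply/vdeg_leP.
by move=> m /bu /lexle_tail/(_ (tailpoly_lexlead kf))[_]; apply.
Qed.

(** First part of the measure for the termination of the loop at a given level. *)
Definition degsum i G : nat := \sum_(f <- G) vdeg i f.

Lemma degsumD1 i G f : f \in G -> degsum i G = (vdeg i f + degsum i (G `\ f))%N.
Proof. exact: big_fsetD1. Qed.

Lemma degsumU1 i G f : (degsum i (f |` G) <= vdeg i f + degsum i G)%N.
Proof.
have [Gf|nGf] := boolP (f \in G); last first.
  by rewrite /degsum big_fsetU1 // leqnn.
suff -> : f |` G = G by exact: leq_addl.
by apply/fsetP => x; rewrite !inE; case: eqP => // ->.
Qed.

Lemma red_step_level i G G' : red_step G G' ->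
  {in G, forall f, tailpoly i f} ->
  {in G', forall f, tailpoly i f} /\ (degsum i G' <= degsum i G)%N.
Proof.
case=> f u Gf /remainder_bounded bu iG; rewrite (degsumD1 i Gf).
have iG' : {in G `\ f, forall g, tailpoly i g}.
  by move=> g; rewrite !inE => /andP[_]; apply: iG.
case: eqP => _; first by split; rewrite ?leq_addl.
split=> [g|].
  rewrite in_fset1U => /predU1P[->|/iG'//].
  exact: lex_bounded_tailpoly (iG _ Gf) bu.
apply: leq_trans (degsumU1 _ _ _) _; rewrite leq_add2r.
by apply: lex_bounded_vdeg bu; apply: iG.
Qed.

Lemma red_level i G R : is_red G R -> {in G, forall f, tailpoly i f} ->
  {in R, forall f, tailpoly i f} /\ (degsum i R <= degsum i G)%N.
Proof.
case=> + _ _ _; elim=> [G1 G2 /red_step_level|G1 iG1|G1 G2 G3 _ IH1 _ IH2 iG1].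
- exact.
- by split=> //; apply: leqnn.
by have [/IH2[iG3 le32] le21] := IH1 iG1; split=> //; apply: leq_trans le21.
Qed.

(** Second part of the measure: the monomials in the ideal of the leading terms. *)
Definition LTset G m : Prop := exists g, [/\ g \in G, g != 0 & (lexlead g <= m)%MM].

Lemma LTset_upset G : upset (LTset G).
Proof.
by move=> m m' le_mm' [g [Gg nz_g le_g]]; exists g; split=> //; apply: lepm_trans le_mm'.
Qed.

(** A monomial that occurs in an element of a monomial ideal is a multiple of one
    of the generators. *)
Lemma ideal_LT_lead G p m : ideal [fset LT f | f in G] p -> m \in msupp p -> LTset G m.
Proof.
move=> Gp; suff sp : p@_m != 0 -> LTset G m by rewrite mcoeff_msupp.
case: (classic (LTset G m)) => // nLT /eqP[]; move: p Gp.
apply: ideal_from_ind => [|p q pm qm|c t _].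
- by rewrite mcoeff0.
- by rewrite mcoeffD pm qm addr0.
case/imfsetP => /= g Gg ->; apply/eqP; rewrite mcoeff_eq0; apply/negP.
move=> /msuppM_le /allpairsP[[m1 m2] /= [_ m2g Em]]; apply: nLT; exists g.
move: m2g; rewrite mcoeff_msupp mcoeffZ mcoeffX.
have [Em2|_] := eqVneq (lexlead g) m2; last by rewrite mulr0 eqxx.
rewrite mulr1 => nz; split=> //; last by rewrite Em Em2 lem_addl.
by apply: contraNneq nz => ->; rewrite mcoeff0.
Qed.

Lemma LT_neq0 p : p != 0 -> lexlead p \in msupp (LT p).
Proof.
move=> /lexleadP[lead_p _]; rewrite mcoeff_msupp mcoeffZ mcoeffX eqxx mulr1.
by rewrite -mcoeff_msupp.
Qed.

Lemma red_LTset G R m : is_red G R -> LTset G m -> LTset R m.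
Proof.
case=> _ _ sLT _ [g [Gg nz_g le_gm]]; apply: (LTset_upset le_gm).
by apply: (ideal_LT_lead _ (LT_neq0 nz_g)); apply/sLT/ideal_gen/in_imfset.
Qed.

Lemma divides_LT p q : p != 0 -> (lexlead p <= lexlead q)%MM -> divides (LT p) (LT q).
Proof.
move=> nz_p le_pq; have [lead_p _] := lexleadP nz_p; rewrite mcoeff_msupp in lead_p.
exists ((q@_(lexlead q) / p@_(lexlead p)) *: 'X_[(lexlead q - lexlead p)%MM]).
rewrite /LT -scalerAl -scalerAr scalerA -mpolyXD submK //.
by rewrite divfK.
Qed.

Lemma divides_LT_lead p q : q != 0 -> divides (LT p) (LT q) ->
  p != 0 /\ (lexlead p <= lexlead q)%MM.
Proof.
move=> nz_q [c Eq]; have := LT_neq0 nz_q; rewrite Eq => /msuppM_le/allpairsP[[m1 m2]] /= [_].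
rewrite mcoeff_msupp mcoeffZ mcoeffX; have [<-|_] := eqVneq (lexlead p) m2; last first.
  by rewrite mulr0 eqxx.
rewrite mulr1 => nz ->; split; last exact: lem_addl.
by apply: contraNneq nz => ->; rewrite mcoeff0.
Qed.

Definition removal f u G : {fset P} := if u == 0 then G `\ f else u |` (G `\ f).

Lemma in_removal f u G g : g \in G -> g != f -> g \in removal f u G.
Proof.
by move=> Gg ne_gf; rewrite /removal; case: ifP => _; rewrite !inE ne_gf Gg ?orbT.
Qed.

(** As f is congruent to u modulo the other elements, it may be replaced by u. *)
Lemma removal_ideal f u G : f \in G -> remainder f (G `\ f) u ->
  forall p, ideal G p <-> ideal (removal f u G) p.
Proof.
move=> Gf [q [Ef _ _]].
have Hu : ideal (removal f u G) u.
  rewrite /removal; case: eqP => [->|_]; first exact: ideal_from0.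
  by apply: ideal_gen; rewrite !inE eqxx.
have sum_in K : (forall g, g \in G `\ f -> ideal K g) -> ideal K (\sum_(g <- G `\ f) q g * g).
  move=> sGK; rewrite big_seq; elim/big_ind: _ => [|a b|g /sGK Kg].
  - exact: ideal_from0.
  - exact: ideal_fromD.
  - exact: idealMl.
have sGfH g : g \in G `\ f -> ideal (removal f u G) g.
  by rewrite !inE => /andP[ne_gf Gg]; apply/ideal_gen/in_removal.
have sGfG g : g \in G `\ f -> ideal G g by rewrite !inE => /andP[_]; apply: ideal_gen.
have Gu : ideal G u.
  have -> : u = f - \sum_(g <- G `\ f) q g * g by rewrite {1}Ef addrC addKr.
  by apply: ideal_fromB; [apply: ideal_gen|apply: sum_in].
move=> p; split; apply: ideal_sub => g.
  move=> Gg; have [->|ne_gf] := eqVneq g f; last by apply/ideal_gen/in_removal.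
  by rewrite [X in ideal _ X]Ef; apply: ideal_fromD => //; apply: sum_in.
rewrite /removal; case: eqP => _; first exact: sGfG.
by rewrite in_fset1U => /predU1P[->|/sGfG].
Qed.

(** No monomial of the remainder is divisible by the leading monomial of f1, which
    divides the one of f2. *)
Lemma small_remainder G f1 f2 : f1 \in G -> f1 != f2 -> divides (LT f1) (LT f2) ->
  exists2 u, remainder f2 (G `\ f2) u & u != 0 -> lexlt (lexlead u) (lexlead f2).
Proof.
move=> Gf1 ne12 dvd12; have [->|nz_f2] := eqVneq f2 0.
  exists 0; rewrite ?eqxx //; exists (fun=> 0); split=> [|g _|m].
  - by rewrite addr0 big1 // => g _; rewrite mul0r.
  - by rewrite mul0r eqxx.
  - by rewrite msupp0.
have [u rem_u] := remainder_exists f2 (G `\ f2); exists u => // nz_u.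
have [lead_u _] := lexleadP nz_u; have [nz_f1 le12] := divides_LT_lead nz_f2 dvd12.
have /lexleP[Eu|//] := remainder_bounded rem_u lead_u.
have [_ [_ _ /(_ _ lead_u f1)]] := rem_u.
by rewrite !inE ne12 Gf1 Eu le12 => /(_ isT nz_f1).
Qed.

(** As long as a leading term divides another one, the element with the latter is
    replaced by its remainder; the multiset of the leading monomials decreases. The
    ideal of the leading terms does not shrink, for the lost leading term is a
    multiple of one that is kept. *)
Lemma red_exists G : exists R, is_red G R.
Proof.
have wf_mon : well_founded (fun p q : P => lexlt (lexlead p) (lexlead q)).
  exact: (Inverse_Image.wf_inverse_image _ _ _ (@lexlead F r) (@wf_lexlt r)).
have [s [uniq_s Es]] : exists s : seq P, uniq s /\ G =i s.
  by exists (enum_fset G); rewrite fset_uniq.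
elim/(well_founded_ind (wf_replace_step wf_mon)): s G uniq_s Es => s IHs G uniq_s Gs.
case: (classic (exists f1 f2, [/\ f1 \in G, f2 \in G, f1 != f2 & divides (LT f1) (LT f2)])).
  case=> f1 [f2 [Gf1 Gf2 ne12 dvd12]].
  have [u rem_u lt_u] := small_remainder Gf1 ne12 dvd12.
  have [s' [uniq_s' Hs' lt_s']] : exists s', [/\ uniq s', removal f2 u G =i s' &
      replace_step (fun p q => lexlt (lexlead p) (lexlead q)) s' s].
    have f2s : f2 \in s by rewrite -Gs.
    case/splitPr: f2s IHs uniq_s Gs => s1 s2 _ uniq_s Gs.
    have Gf2s : G `\ f2 =i s1 ++ s2.
      move=> x; rewrite !inE Gs !mem_cat inE.
      move: uniq_s; rewrite uniq_catC /= => /andP[+ _]; rewrite mem_cat negb_or.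
      by case: eqP => [->|] //= /andP[/negbTE-> /negbTE->].
    have uniq12 : uniq (s1 ++ s2).
      by move: uniq_s; rewrite uniq_catC /= => /andP[_]; rewrite uniq_catC.
    rewrite /removal; case: eqP => [_|/eqP/lt_u lt_u2].
      exists (s1 ++ s2); split; [exact: uniq12|exact: Gf2s|].
      exact: (@ReplaceStep _ _ s1 f2 s2 [::] (List.Forall_nil _)).
    have [s12u|ns12u] := boolP (u \in s1 ++ s2).
      exists (s1 ++ s2); split; [exact: uniq12| |].
        2: exact: (@ReplaceStep _ _ s1 f2 s2 [::] (List.Forall_nil _)).
      by move=> x; rewrite in_fset1U Gf2s; case: eqP => // ->.
    exists (s1 ++ [:: u] ++ s2); split.
    - by rewrite uniq_catCA /= ns12u.
    - by move=> x; rewrite in_fset1U Gf2s !mem_cat inE orbCA.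
    - by apply: ReplaceStep; constructor; [exact: lt_u2|constructor].
  have [R [step_R R_min sLT sId]] := IHs _ lt_s' _ uniq_s' Hs'.
  exists R; split=> // [|p|p].
  - apply: rt_trans step_R; apply: rt_step; exact: RedStep.
  - move=> Gp; apply: sLT; apply: ideal_sub Gp => _ /imfsetP[/= f Gf ->].
    have [->|ne_f] := eqVneq f f2; last by apply/ideal_gen/in_imfset/in_removal.
    case: dvd12 => c ->; apply/idealMl/ideal_gen/in_imfset; exact: in_removal.
  - by rewrite -sId; apply: removal_ideal.
move=> none; exists G; split=> //; first exact: rt_refl.
by move=> f1 f2 Gf1 Gf2 ne12 dvd12; apply: none; exists f1, f2.
Qed.

End Reduction.

(** * Pseudo-division with respect to one variable *)

Lemma size_cancel_lead (R : comNzRingType) (p q : {poly R}) :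
  (0 < size q <= size p)%N ->
  (size ((lead_coef q)%:P * p - (lead_coef p)%:P * 'X^(size p - size q) * q)%R
    <= (size p).-1)%N.
Proof.
case/andP=> q_gt0 le_qp; apply/leq_sizeP => l le_pl; rewrite coefB -mulrA !coefCM coefXnM.
have le_pql : (size p - size q <= l)%N.
  by apply: leq_trans le_pl; rewrite -subn1 leq_sub2l.
rewrite ltnNge le_pql /=; have p_gt0 := leq_trans q_gt0 le_qp.
have [lt_pl|le_lp] := leqP (size p) l.
  rewrite !nth_default ?mulr0 ?subrr //.
  by rewrite leq_subRL // subnK.
have El : l = (size p).-1 by apply/eqP; rewrite eqn_leq le_pl andbT -ltnS prednK.
have -> : (l - (size p - size q))%N = (size q).-1.
  by rewrite El -subn1 subnAC subKn // subn1.
by rewrite El -!lead_coefE mulrC subrr.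
Qed.

Section PseudoDivision.
Variables (F : fieldType) (r : nat).
Local Notation P := {mpoly F[r]}.
Implicit Types (p q f g h b c u : P) (G H R : {fset P}) (k l n m : nat) (i j : 'I_r).

Lemma expand_tailpoly k i b : (i < k)%N -> tailpoly k b -> expand i b = b%:P.
Proof. by move=> ltik kb; apply: expand_free; apply: tailpoly_free ltik kb. Qed.

Lemma vdeg_freeM i b p : b != 0 -> vdeg i b = 0%N -> vdeg i (b * p) = vdeg i p.
Proof.
by move=> nz_b b0; rewrite /vdeg expandM (expand_free b0) size_Cmul.
Qed.

Lemma vcoef_freeM i l b p : vdeg i b = 0%N -> vcoef i l (b * p) = b * vcoef i l p.
Proof. by move=> b0; rewrite /vcoef expandM (expand_free b0) coefCM. Qed.

Lemma tailpoly_vlead i f : tailpoly i f -> tailpoly i.+1 (vlead i f).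
Proof. by rewrite vleadE; apply: tailpolyS_vcoef. Qed.

Lemma vdeg_vlead i f : vdeg i (vlead i f) = 0%N.
Proof. by apply/vdeg0P; apply: vcoef_free. Qed.

Lemma vdeg_gt0_neq0 i f : (0 < vdeg i f)%N -> f != 0.
Proof. by apply: contraTneq => ->; rewrite /vdeg rmorph0 size_poly0. Qed.

(** By induction on the degree of f in T_i, cancelling its leading term. The last
    clause keeps track of the variables that do not occur. *)
Lemma pseudo_division i f h : (0 < vdeg i h)%N ->
  exists n a u, [/\ vlead i h ^+ n * f = a * h + u, (vdeg i u < vdeg i h)%N
    & tailpoly i f -> tailpoly i h -> tailpoly i a /\ tailpoly i u].
Proof.
move=> h_gt0; have [N ltfN] := ubnP (vdeg i f); elim: N f ltfN => // N IHN f ltfN.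
have [lt_fh|le_hf] := ltnP (vdeg i f) (vdeg i h).
  exists 0%N, 0, f; split=> // [|if_ ih]; first by rewrite expr0 mul1r mul0r add0r.
  by split=> //; apply: tailpoly_zero.
have f_gt0 : (0 < vdeg i f)%N by apply: leq_trans le_hf.
have nz_h := vdeg_gt0_neq0 h_gt0; have nz_f := vdeg_gt0_neq0 f_gt0.
have [n En] : exists n, n = (size (expand i f) - size (expand i h))%N by eexists.
pose t := vlead i f * 'X_i ^+ n; pose f1 := vlead i h * f - t * h.
have expand_t : expand i t = (vlead i f)%:P * 'X^n.
  by rewrite expandM expandXn expandX eqxx expand_free // vdeg_vlead.
have lt_f1 : (vdeg i f1 < N)%N.
  apply: leq_trans (_ : (vdeg i f <= N)%N); last by rewrite -ltnS.
  apply: vdeg_lt_size => //.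
  rewrite expandB (expandM i (vlead i h)) (expandM i t) expand_t expand_free ?vdeg_vlead //.
  have /size_cancel_lead : (0 < size (expand i h) <= size (expand i f))%N.
    by rewrite !size_expand // ltnS.
  by rewrite -En (size_expand i nz_f).
have [m [a [u [Ef1 lt_u tail_au]]]] := IHN f1 lt_f1.
exists m.+1, (a + vlead i h ^+ m * t), u; split=> // [|if_ ih].
  have Ebf : vlead i h * f = f1 + t * h by rewrite subrK.
  by rewrite exprSr -mulrA Ebf mulrDr Ef1 mulrDl mulrA addrAC.
have tail_lead x : tailpoly i x -> tailpoly i (vlead i x) by apply: tailpoly_vcoef.
have it : tailpoly i t by apply: tailpolyM; [exact: tail_lead|apply/tailpolyXn/tailpolyXU].
have [|//|ia iu] := tail_au.
  by apply: tailpolyB; apply: tailpolyM => //; apply: tail_lead.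
by split=> //; apply: tailpolyD => //; apply: tailpolyM => //; apply/tailpolyXn/tail_lead.
Qed.

Lemma size_drop_lead i g : g != 0 ->
  (size (expand i (g - vlead i g * 'X_i ^+ vdeg i g)) <= vdeg i g)%N.
Proof.
move=> nz_g; have -> : expand i (g - vlead i g * 'X_i ^+ vdeg i g) =
    expand i g - (vlead i g)%:P * 'X^(vdeg i g).
  by rewrite expandB expandM expandXn expandX eqxx (expand_free (vdeg_vlead i g)).
apply/leq_sizeP => l; rewrite leq_eqVlt coefB coefCM coefXn => /predU1P[<-|lt_dl].
  by rewrite eqxx mulr1 subrr.
by rewrite gtn_eqF // mulr0 subr0 nth_default // (size_expand i nz_g).
Qed.

Lemma vdeg_free i b : tailpoly i.+1 b -> vdeg i b = 0%N.
Proof. exact: tailpoly_free. Qed.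

(** Over the field of fractions, where the divisions in case (a) take place. *)
Definition expandF i f : {poly {fraction P}} :=
  map_poly (@FracField.tofrac P) (expand i f).

Lemma uniF_expandF : @uniF F r = expandF.
Proof. by rewrite /uniF uni_expand. Qed.

Lemma expandFD i p q : expandF i (p + q) = expandF i p + expandF i q.
Proof. by rewrite /expandF expandD rmorphD. Qed.

Lemma expandFM i p q : expandF i (p * q) = expandF i p * expandF i q.
Proof. by rewrite /expandF expandM rmorphM. Qed.

Lemma expandF_free i b p : vdeg i b = 0%N ->
  expandF i (b * p) = FracField.tofrac b *: expandF i p.
Proof.
by move=> b0; rewrite /expandF expandM expand_free // rmorphM /= map_polyC mul_polyC.
Qed.

Lemma tofrac_inj : injective (@FracField.tofrac P).
Proof. by move=> p q /eqP; rewrite tofrac_eq => /eqP. Qed.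

Lemma expandF_inj i : injective (expandF i).
Proof.
move=> p q; rewrite /expandF => /(map_inj_poly tofrac_inj (rmorph0 _)).
exact: expand_inj.
Qed.

Lemma size_expandF i f : size (expandF i f) = size (expand i f).
Proof. by rewrite /expandF size_map_inj_poly ?rmorph0 //; apply: tofrac_inj. Qed.

Lemma expandF_eq0 i f : (expandF i f == 0) = (f == 0).
Proof. by rewrite -size_poly_eq0 size_expandF size_poly_eq0 expand_eq0. Qed.

Lemma ltn_vdeg i u h : (0 < vdeg i h)%N ->
  (size (expand i u) < size (expand i h))%N = (vdeg i u < vdeg i h)%N.
Proof. by rewrite /vdeg; case: (size (expand i h)) => [|[|n]] // _; case: (size _). Qed.

(** The quotient and the remainder of case (a) are determined by the exponent n, so
    u is compared to the remainder of a pseudo-division: up to factors free of the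
    earlier variables they agree, hence these variables do not occur in u. *)
Lemma exact_division i f h n a u :
    tailpoly i f -> tailpoly i h -> (0 < vdeg i h)%N ->
    expandF i a = FracField.tofrac (vlead i h) ^+ n *: (expandF i f %/ expandF i h) ->
    expandF i u = FracField.tofrac (vlead i h) ^+ n *: (expandF i f %% expandF i h) ->
  [/\ vlead i h ^+ n * f = a * h + u, (vdeg i u < vdeg i h)%N & tailpoly i u].
Proof.
move=> if_ ih h_gt0 Ea Eu; set b := vlead i h in Ea Eu *.
have ib k : tailpoly i.+1 (b ^+ k) by apply/tailpolyXn/tailpoly_vlead.
have b0 k : vdeg i (b ^+ k) = 0%N by apply: vdeg_free.
have nz_h : h != 0 by apply: contraTneq h_gt0 => ->; rewrite /vdeg rmorph0 size_poly0.
have nz_b : b != 0 by rewrite vlead_eq0.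
have nz_H : expandF i h != 0 by rewrite expandF_eq0.
have Ef : b ^+ n * f = a * h + u.
  apply: (@expandF_inj i); rewrite expandFD expandFM expandF_free // Ea Eu rmorphXn /=.
  by rewrite -scalerAl -scalerDr -divp_eq.
have lt_u : (vdeg i u < vdeg i h)%N.
  rewrite -ltn_vdeg // -!size_expandF Eu; apply: leq_ltn_trans (size_scale_leq _ _) _.
  by rewrite ltn_modp.
split=> //; have [k [a0 [u0 [Ef0 lt_u0 /(_ if_ ih)[ia0 iu0]]]]] := pseudo_division f h_gt0.
have Eu0 : expandF i u0 = FracField.tofrac b ^+ k *: (expandF i f %% expandF i h).
  rewrite -modpZl -rmorphXn -expandF_free // -/b in Ef0 *; apply: (@modpP _ _ (expandF i a0)).
    by rewrite Ef0 expandFD expandFM.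
  by rewrite !size_expandF ltn_vdeg.
have Ebu : b ^+ k * u = b ^+ n * u0.
  apply: (@expandF_inj i); rewrite !expandF_free // Eu Eu0 !rmorphXn /=.
  by rewrite !scalerA mulrC.
apply/forallP => j; apply/implyP => ltji.
have nz_bX m1 : b ^+ m1 != 0 by rewrite expf_neq0.
have j0 p : tailpoly i p -> vdeg j p = 0%N by apply: tailpoly_free.
have ib' m1 : tailpoly i (b ^+ m1) by apply: tailpoly_leq (ib m1).
rewrite -(vdeg_freeM u (nz_bX k) (j0 _ (ib' k))) Ebu.
by rewrite vdeg_freeM ?j0.
Qed.

Lemma division_exists i f h :
    tailpoly i f -> tailpoly i h -> (0 < vdeg i h)%N ->
  exists n a u,
    expandF i a = FracField.tofrac (vlead i h) ^+ n *: (expandF i f %/ expandF i h) /\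
    expandF i u = FracField.tofrac (vlead i h) ^+ n *: (expandF i f %% expandF i h).
Proof.
move=> if_ ih h_gt0; have [n [a [u [Ef lt_u _]]]] := pseudo_division f h_gt0.
have b0 : vdeg i (vlead i h ^+ n) = 0%N by apply/vdeg_free/tailpolyXn/tailpoly_vlead.
exists n, a, u; rewrite -divpZl -modpZl -rmorphXn /= -expandF_free //.
have lt_sz : (size (expandF i u) < size (expandF i h))%N.
  by rewrite !size_expandF ltn_vdeg.
have Ef' : expandF i (vlead i h ^+ n * f) = expandF i a * expandF i h + expandF i u.
  by rewrite Ef expandFD expandFM.
by split; [apply: divpP Ef' lt_sz|apply: modpP Ef' lt_sz].
Qed.

End PseudoDivision.

(** * Splitting a system *)

Lemma Forall_map_seq (T : eqType) (A : Type) (Q : A -> Prop) (h : T -> A) (s : seq T) :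
  List.Forall Q [seq h x | x <- s] <-> {in s, forall x, Q (h x)}.
Proof.
elim: s => [|x s IHs] /=; first by split=> // _; constructor.
split=> [sQ y|sQ].
  rewrite inE => /predU1P[->|]; first exact: List.Forall_inv sQ.
  by apply/IHs: y; apply: List.Forall_inv_tail sQ.
constructor; first by apply: sQ; rewrite inE eqxx.
by apply/IHs => y sy; apply: sQ; rewrite inE sy orbT.
Qed.

Lemma Forall_cons_iff (A : Type) (Q : A -> Prop) x (s : seq A) :
  List.Forall Q (x :: s) <-> Q x /\ List.Forall Q s.
Proof.
split=> [sQ|[Qx sQ]]; last by constructor.
by split; [apply: List.Forall_inv sQ|apply: List.Forall_inv_tail sQ].
Qed.

Section Splitting.
Variables (F : fieldType) (r : nat).
Local Notation P := {mpoly F[r]}.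
Implicit Types (p q f g h b c u a : P) (G H R : {fset P}) (k l n : nat) (i j : 'I_r).
Implicit Types S : system F r.

(** Over an algebraically closed field: the system has no solution. *)
Definition unsolvable S : Prop := in_radical (sq S `|` tri S) (gpol S).

Lemma semi_triangularE S : semi_triangular S <->
  [/\ (lvl S <= r)%N, triangular_shape (tri S),
      {in tri S, forall f i, pivot f i -> divides (vlead i f) (gpol S)},
      {in tri S, forall f i, pivot f i -> (i < lvl S)%N}
    & {in sq S, forall f, tailpoly (lvl S) f}].
Proof.
rewrite /semi_triangular LC_vlead degT_vdeg.
split=> -[h1 h2 h3 h4 h5]; split=> // f sf.
  by apply/forallP => j; apply/implyP => /(h5 _ sf)->.
by move=> i lti; apply: tailpoly_free lti _; apply: h5.
Qed.

Definition vhead i f n : P := \sum_(l < n) vcoef i l f * 'X_i ^+ l.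
Definition vtail i f n : {fset P} := [fset vcoef i l f | l in iota n ((vdeg i f).+1 - n)].

Lemma branchE S i f n : branch S i f n =
  System ((sq S `\ f) `|` vtail i f n.+1) (vhead i f n.+1 |` tri S)
    (lvl S).+1 (gpol S * vcoef i n f).
Proof. by rewrite /branch /tail_coefs /head_part coefT_vcoef degT_vdeg. Qed.

Lemma branch_lastE S i f : branch_last S i f =
  System ((sq S `\ f) `|` vtail i f 0) (tri S) (lvl S).+1 (gpol S).
Proof. by rewrite /branch_last /tail_coefs coefT_vcoef degT_vdeg. Qed.

Lemma expand_vhead i f n : expand i (vhead i f n) = \poly_(l < n) vcoef i l f.
Proof.
rewrite /vhead rmorph_sum poly_def /=; apply: eq_bigr => l _.
rewrite expandM expandXn expandX eqxx expand_free ?mul_polyC //.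
by apply/vdeg0P; apply: vcoef_free.
Qed.

Lemma vlead_vhead i f n : vcoef i n f != 0 ->
  vlead i (vhead i f n.+1) = vcoef i n f /\ vdeg i (vhead i f n.+1) = n.
Proof.
by move=> nz; rewrite /vlead /vdeg expand_vhead lead_coef_poly // size_poly_eq.
Qed.

Lemma tailpoly_vhead k i f n : (k <= i)%N -> tailpoly k f -> tailpoly k (vhead i f n).
Proof.
move=> le_ki kf; rewrite /vhead; elim/big_ind: _ => [|p q|l _].
- exact: tailpoly_zero.
- exact: tailpolyD.
- by apply: tailpolyM; [apply: tailpoly_vcoef|apply/tailpolyXn/tailpolyXU].
Qed.

Lemma in_vtail i f n c : c \in vtail i f n ->
  exists2 l, c = vcoef i l f & (n <= l <= vdeg i f)%N.
Proof.
case/imfsetP => /= l; rewrite mem_iota => /andP[le_nl lt_l] ->; exists l => //.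
rewrite le_nl -ltnS; case: (leqP n (vdeg i f).+1) lt_l => [le_nd|lt_dn].
  by rewrite subnKC.
by rewrite (eqP (ltnW lt_dn)) addn0 ltnNge le_nl.
Qed.

Lemma vtail_vcoef i f n l : (n <= l <= vdeg i f)%N -> vcoef i l f \in vtail i f n.
Proof.
case/andP=> le_nl le_ld; apply: in_imfset; rewrite /= mem_iota le_nl /=.
by rewrite subnKC ?ltnS // leqW // (leq_trans le_nl).
Qed.

(** The element added in case (b) has a later pivot than all the others, so it
    comes last. *)
Lemma triangular_shapeU1 G f i : triangular_shape G -> pivot f i ->
  {in G, forall g j, pivot g j -> (j < i)%N} -> triangular_shape (f |` G).
Proof.
case=> s [e [k [-> piv_e incr_k]]] piv_f lt_i.
pose e' (a : 'I_s.+1) := if unlift ord_max a is Some a' then e a' else f.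
pose k' (a : 'I_s.+1) := if unlift ord_max a is Some a' then k a' else i.
exists s.+1, e', k'; split=> [|a|a b].
- apply/fsetP => x; rewrite in_fset1U; apply/predU1P/imfsetP => /=.
    case=> [->|/imfsetP[/= a _ ->]]; last by exists (lift ord_max a); rewrite // /e' liftK.
    by exists ord_max => //; rewrite /e' unlift_none.
  case=> a _ ->; rewrite /e'; case: unliftP => [a' _|_]; last by left.
  by right; apply: in_imfset.
- by rewrite /e' /k'; case: (unlift ord_max a) => [a'|]; [exact: piv_e|exact: piv_f].
- rewrite /k'; case: (unliftP ord_max a) => [a'|] ->; case: (unliftP ord_max b) => [b'|] ->.
  + by rewrite !lift_max; apply: incr_k.
  + by move=> _; apply: lt_i (piv_e a'); apply: in_imfset.
  + by rewrite lift_max /= ltnNge -ltnS ltnS (ltnW (ltn_ord b')).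
  + by rewrite ltnn.
Qed.

Lemma divides_mull p q c : divides p q -> divides p (c * q).
Proof. by case=> d ->; exists (c * d); rewrite mulrA. Qed.

(** In case (b), either a_n is nonzero and hence the leading coefficient of f_n, or
    the new g is zero, which everything divides. *)
Lemma split_semi_triangular S i M : semi_triangular S -> i = lvl S :> nat ->
  split_step S i M -> List.Forall (@semi_triangular F r) M.
Proof.
case: S => G T k g /= /semi_triangularE[/= le_kr shape_T lead_T piv_T tail_G] Ei.
rewrite -Ei in tail_G piv_T *; have lt_ir := ltn_ord i; have le_ir := ltnW lt_ir.
case.
- rewrite /= uniF_expandF degT_vdeg LC_vlead => f h n a u Gf f_gt0.
  rewrite !inE => /andP[ne_hf Gh] h_gt0 le_hf Ea Eu.
  have [_ _ iu] := exact_division (tail_G _ Gf) (tail_G _ Gh) h_gt0 Ea Eu.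
  constructor; [|constructor; [|by constructor]]; apply/semi_triangularE; split=> //= x.
  + by move=> Tx j /(lead_T x Tx); apply: divides_mull.
  + by rewrite !inE => /predU1P[->//|/andP[_ /tail_G]].
  + rewrite !inE => /predU1P[->|/tail_G//].
    by apply: (@tailpoly_leq _ _ i i.+1) => //; apply: tailpoly_vlead; apply: tail_G.
- rewrite /= degT_vdeg => f Gf f_gt0 others0.
  have tail_rest n : {in (G `\ f) `|` vtail i f n, forall x, tailpoly i.+1 x}.
    move=> x; rewrite in_fsetU => /orP[Gx|/in_vtail[l -> _]].
      rewrite tailpolyS others0 // eqxx andbT tail_G //.
      by move: Gx; rewrite !inE => /andP[].
    by apply: tailpolyS_vcoef; apply: tail_G.
  apply/Forall_cons_iff; split.
    rewrite branch_lastE; apply/semi_triangularE; split=> //= x Tx j piv_x.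
    by rewrite ltnS ltnW // (piv_T x).
  apply/Forall_map_seq => n; rewrite mem_filter => /andP[head_gt0 _].
  rewrite branchE /=; move: head_gt0.
  rewrite /head_part coefT_vcoef -/(vhead _ _ _) => head_gt0.
  have piv_head : pivot (vhead i f n.+1) i.
    by apply/pivotP; split=> //; apply: tailpoly_vhead => //; apply: tail_G.
  apply/semi_triangularE; split=> //=.
  + exact: triangular_shapeU1 piv_head _.
  + move=> x; rewrite in_fset1U => /predU1P[->|Tx] j piv_x; last first.
      by rewrite mulrC; apply: divides_mull; apply: lead_T piv_x.
    rewrite -(pivot_inj piv_head piv_x).
    have [->|nz_c] := eqVneq (vcoef i n f) 0; first by exists 0; rewrite mulr0 mul0r.
    by have [-> _] := vlead_vhead nz_c; exists g.
  + move=> x; rewrite in_fset1U => /predU1P[->|Tx] j piv_x.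
      by rewrite -(pivot_inj piv_head piv_x).
    by rewrite ltnS ltnW // (piv_T x).
- rewrite /= degT_vdeg => all0; constructor=> //; apply/semi_triangularE; split=> //= x.
    by move=> Tx j piv_x; rewrite ltnS ltnW // (piv_T x).
  by move=> Gx; rewrite tailpolyS all0 // eqxx tail_G.
Qed.

Lemma in_radical_eq G H g : (forall p, p \in G -> ideal H p) ->
  (forall p, p \in H -> ideal G p) -> in_radical G g <-> in_radical H g.
Proof.
by move=> sGH sHG; split; apply: in_radical_sub => p; apply: ideal_sub.
Qed.

(** Case (a). The systems are compared by splitting along b; after inversion of b,
    the relation b^n f = a h + u allows f to be exchanged with u. *)
Lemma divide_unsolvable G T f h a u b n g : f \in G -> h \in G -> h != f ->
    b ^+ n * f = a * h + u ->
  in_radical (G `|` T) g <->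
  in_radical ((u |` (G `\ f)) `|` T) (b * g) /\ in_radical ((b |` G) `|` T) g.
Proof.
move=> Gf Gh ne_hf Ef; rewrite (in_radical_split _ b g) -(fsetUA [fset b]).
suff E : in_radical (G `|` T) (b * g) <-> in_radical ((u |` (G `\ f)) `|` T) (b * g).
  by split=> -[? ?]; split=> //; apply/E.
have H'h : ideal ((u |` (G `\ f)) `|` T) h.
  by apply: ideal_gen; rewrite !inE Gh ne_hf !orbT.
have H'u : ideal ((u |` (G `\ f)) `|` T) u by apply: ideal_gen; rewrite !inE eqxx.
split; apply: in_radical_transfer => p.
  have [-> _|ne_pf] := eqVneq p f.
    exists n; rewrite exprMn mulrAC Ef mulrC.
    by apply/idealMl/ideal_fromD; first exact: idealMl.
  move=> Gp; exists 0%N; rewrite expr0 mul1r; apply: ideal_gen.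
  by move: Gp; rewrite !inE ne_pf /= => /orP[]->; rewrite ?orbT.
move=> Hp; exists 0%N; rewrite expr0 mul1r; move: Hp.
rewrite in_fsetU in_fset1U -orbA => /predU1P[->|].
  have -> : u = b ^+ n * f - a * h by rewrite Ef addrC addKr.
  by apply: ideal_fromB; apply/idealMl/ideal_gen; rewrite inE ?Gf ?Gh.
rewrite !inE => Hp; apply: ideal_gen; rewrite inE.
by case/orP: Hp => [/andP[_]|]->; rewrite ?orbT.
Qed.

Lemma vheadS i f n : vhead i f n.+1 = vhead i f n + vcoef i n f * 'X_i ^+ n.
Proof. by rewrite /vhead big_ord_recr. Qed.

(** Case (b). Splitting along the coefficients a_d, a_(d-1), ... of f in turn
    shortens f, as a_n = 0 turns f_n into f_(n-1). *)
Lemma lead_unsolvable G T f i g : f \in G ->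
  in_radical (G `|` T) g <->
  in_radical (((G `\ f) `|` vtail i f 0) `|` T) g /\
  (forall n, (n <= vdeg i f)%N ->
     in_radical (((G `\ f) `|` vtail i f n.+1) `|` (vhead i f n.+1 |` T)) (g * vcoef i n f)).
Proof.
move=> Gf; pose A n := ((G `\ f) `|` vtail i f n) `|` (vhead i f n |` T).
have memA n p : p \in A n =
    [|| (p != f) && (p \in G), p \in vtail i f n, p == vhead i f n | p \in T].
  by rewrite !in_fsetU in_fset1 in_fsetD1 -orbA.
have AGT n p : p \in G `|` T -> p != f -> ideal (A n) p.
  rewrite in_fsetU => GTp ne_pf; apply: ideal_gen; rewrite memA ne_pf.
  by case/orP: GTp => ->; rewrite ?orbT.
have AT n p : p \in T -> ideal (A n) p.
  by move=> Tp; apply: ideal_gen; rewrite memA Tp !orbT.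
have Avtail n l : (n <= l <= vdeg i f)%N -> ideal (A n) (vcoef i l f).
  by move=> /vtail_vcoef tl; apply: ideal_gen; rewrite memA tl !orbT.
have Ahead n : ideal (A n) (vhead i f n) by apply: ideal_gen; rewrite memA eqxx !orbT.
have Aelim n p : p \in A n -> [\/ p \in G `|` T /\ p != f, p \in T,
    exists2 l, p = vcoef i l f & (n <= l <= vdeg i f)%N | p = vhead i f n].
  rewrite memA => /or4P[/andP[ne_pf Gp]|/in_vtail tl|/eqP->|Tp].
  - by apply: Or41; rewrite in_fsetU Gp.
  - exact: Or43.
  - exact: Or44.
  - exact: Or42.
have {memA} A0E p : p \in A 0 = (p \in ((G `\ f) `|` vtail i f 0) `|` T) || (p == vhead i f 0).
  by rewrite memA !in_fsetU in_fsetD1 -!orbA [(_ == _) || _]orbC.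
have EA n : A n = ((G `\ f) `|` vtail i f n) `|` (vhead i f n |` T) by [].
move: A AGT AT Avtail Ahead Aelim A0E EA => A AGT AT Avtail Ahead Aelim A0E EA.
have unfoldA n : (n <= (vdeg i f).+1)%N -> in_radical (A n) g <-> in_radical (A 0) g /\
    (forall l, (l < n)%N -> in_radical (A l.+1) (g * vcoef i l f)).
  elim: n => [_|n IHn lt_n]; first by split=> [A0|[A0 _]]; [split|].
  rewrite (in_radical_split _ (vcoef i n f)).
  have -> : in_radical (vcoef i n f |` A n.+1) g <-> in_radical (A n) g.
    apply: in_radical_eq => p.
      rewrite in_fset1U => /predU1P[->|/Aelim[[GTp ne_pf]|Tp|[l -> /andP[lt_nl le_l]]|->]].
      - by apply: Avtail; rewrite leqnn.
      - exact: AGT.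
      - exact: AT.
      - by apply: Avtail; rewrite ltnW.
      - rewrite vheadS [vcoef _ _ _ * _]mulrC; apply: ideal_fromD.
          exact: Ahead.
        by apply: idealMl; apply: Avtail; rewrite leqnn.
    have sub q : ideal (A n.+1) q -> ideal (vcoef i n f |` A n.+1) q.
      by apply: ideal_subset => x Ax; rewrite in_fset1U Ax orbT.
    have cn : ideal (vcoef i n f |` A n.+1) (vcoef i n f).
      by apply: ideal_gen; rewrite in_fset1U eqxx.
    move=> /Aelim[[GTp ne_pf]|Tp|[l -> /andP[]]|->].
    - by apply: sub; apply: AGT.
    - exact/sub/AT.
    - rewrite leq_eqVlt => /predU1P[<-//|lt_nl] le_l.
      by apply: sub; apply: Avtail; rewrite lt_nl.
    - have -> : vhead i f n = vhead i f n.+1 - 'X_i ^+ n * vcoef i n f.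
        by rewrite vheadS [_ * vcoef _ _ _]mulrC addrK.
      by apply: ideal_fromB; [apply: sub|apply: idealMl].
  rewrite (IHn (ltnW lt_n)) mulrC; split=> [[An [A0 Al]]|[A0 Al]].
    by split=> // l; rewrite ltnS leq_eqVlt => /predU1P[->//|]; apply: Al.
  split; first exact: Al; split=> // l lt_l; apply: Al; exact: ltnW.
have -> : in_radical (G `|` T) g <-> in_radical (A (vdeg i f).+1) g.
  have Ef : vhead i f (vdeg i f).+1 = f by rewrite /vhead -vcoef_sum.
  apply: in_radical_eq => p.
    have [-> _|ne_pf GTp] := eqVneq p f; last exact: AGT.
    by rewrite -[X in ideal _ X]Ef.
  move=> /Aelim[[GTp _]|Tp|[l _ /andP[lt_l]]|->].
  - exact: ideal_gen.
  - by apply: ideal_gen; rewrite inE Tp orbT.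
  - by rewrite leqNgt lt_l.
  - by rewrite Ef; apply: ideal_gen; rewrite inE Gf.
rewrite unfoldA //.
suff E : in_radical (A 0) g <-> in_radical (((G `\ f) `|` vtail i f 0) `|` T) g.
  split=> -[/E A0 Al]; split=> // l le_l; first by rewrite -EA; apply: Al.
  by rewrite EA; apply: Al.
have head0 : vhead i f 0 = 0 by rewrite /vhead big_ord0.
apply: in_radical_eq => p.
  rewrite A0E head0 => /orP[Hp|/eqP->]; [exact: ideal_gen|exact: ideal_from0].
by move=> Hp; apply: ideal_gen; rewrite A0E Hp.
Qed.

(** The systems left out of the list in case (b), and the one for n = 0, are
    unsolvable: either a_n = 0, or a_0 = f_0 is one of the equations. *)
Lemma split_unsolvable S i M : semi_triangular S -> i = lvl S :> nat ->
  split_step S i M -> unsolvable S <-> List.Forall unsolvable M.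
Proof.
case: S => G T k g /= /semi_triangularE[/= le_kr shape_T lead_T piv_T tail_G] Ei.
rewrite -Ei in tail_G piv_T *.
case.
- rewrite /= uniF_expandF degT_vdeg LC_vlead => f h n a u Gf f_gt0.
  rewrite !inE => /andP[ne_hf Gh] h_gt0 le_hf Ea Eu.
  have [Ef _ _] := exact_division (tail_G _ Gf) (tail_G _ Gh) h_gt0 Ea Eu.
  rewrite !Forall_cons_iff /unsolvable /= (divide_unsolvable T g Gf Gh ne_hf Ef).
  by split=> [[? ?]|[? []]]; split=> //; split=> //; constructor.
- rewrite /= degT_vdeg => f Gf f_gt0 others0.
  rewrite Forall_cons_iff; have [unfold_lead fold_lead] := lead_unsolvable T i g Gf.
  split=> [/unfold_lead[H0 Hn]|[H0 Hn]].
    split; first by rewrite branch_lastE.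
    apply/Forall_map_seq => n; rewrite mem_filter mem_iota => /andP[_ /andP[_ lt_n]].
    by rewrite branchE; apply: Hn; rewrite -ltnS -add1n.
  apply: fold_lead; split; first by rewrite branch_lastE in H0.
  move=> n le_n; have [->|n_gt0] := posnP n.
    exists 1%N; rewrite expr1; apply/idealMl/ideal_gen.
    have -> : vhead i f 1 = vcoef i 0 f by rewrite /vhead big_ord1 expr0 mulr1.
    by rewrite !in_fsetU in_fset1 eqxx !orbT.
  have [head0|head_gt0] := posnP (vdeg i (vhead i f n.+1)).
    have -> : vcoef i n f = 0.
      apply/eqP; apply: contraTT n_gt0 => /vlead_vhead[_].
      by rewrite head0 => <-.
    by exists 1%N; rewrite expr1 mulr0; apply: ideal_from0.
  move/Forall_map_seq: Hn => /(_ n); rewrite mem_filter mem_iota branchE; apply.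
  by rewrite /head_part coefT_vcoef -/(vhead _ _ _) head_gt0 n_gt0 add1n ltnS.
- rewrite /= degT_vdeg => all0; rewrite Forall_cons_iff.
  by split=> [|[]//]; split=> //; constructor.
Qed.

Lemma split_exists S i : semi_triangular S -> i = lvl S :> nat ->
  exists M, split_step S i M.
Proof.
case: S => G T k g /= /semi_triangularE[/= _ _ _ _ tail_G] Ei; rewrite -Ei in tail_G *.
case: (classic (exists2 f, f \in G & (0 < vdeg i f)%N)); last first.
  move=> none; exists [:: System G T k.+1 g]; rewrite Ei; apply: SplitNone => f /= Gf.
  rewrite degT_vdeg; apply/eqP; rewrite -leqn0 leqNgt; apply/negP => f_gt0.
  by apply: none; exists f.
case=> f0 Gf0 f0_gt0.
case: (classic (exists2 h0, h0 \in G `\ f0 & (0 < vdeg i h0)%N)); last first.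
  move=> none; eexists; apply: (@SplitLead _ _ _ _ f0) => //=; rewrite degT_vdeg //.
  move=> h Gh; apply/eqP; rewrite -leqn0 leqNgt; apply/negP => h_gt0.
  by apply: none; exists h.
case=> h0; rewrite !inE => /andP[ne_h0f0 Gh0] h0_gt0.
have [f [h [Gf Gh ne_hf f_gt0 [h_gt0 le_hf]]]] : exists f h,
    [/\ f \in G, h \in G, h != f, (0 < vdeg i f)%N
      & (0 < vdeg i h)%N /\ (vdeg i h <= vdeg i f)%N].
  have [le_h0f0|lt_f0h0] := leqP (vdeg i h0) (vdeg i f0); first by exists f0, h0.
  by exists h0, f0; split=> //; [rewrite eq_sym|split=> //; apply: ltnW].
have [n [a [u [Ea Eu]]]] := division_exists (tail_G _ Gf) (tail_G _ Gh) h_gt0.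
eexists; apply: (@SplitDivide _ _ _ _ f h n a u);
  rewrite /= ?degT_vdeg ?LC_vlead ?uniF_expandF //.
by rewrite !inE ne_hf.
Qed.

(** The leading monomial of h is that of its leading coefficient in T_i times a
    power of T_i, as T_i is the first variable that may occur. *)
Lemma lexlead_vlead i h : tailpoly i h -> h != 0 ->
  (lexlead (vlead i h) <= lexlead h)%MM /\ lexlead (vlead i h) i = 0%N.
Proof.
move=> ih nz_h; have [lead_h max_h] := lexleadP nz_h.
pose m := lexlead h; have Emi := vdeg_lexlead ih; pose m' := (m - U_(i) *+ m i)%MM.
have Em : m = (m' + U_(i) *+ m i)%MM.
  apply/mnmP => j; rewrite mnmDE mnmBE mulmnE mnm1E eq_sym.
  by case: eqVneq => [<-|_]; rewrite ?mul1n ?subnK // mul0n subn0 addn0.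
have m'i : m' i = 0%N by rewrite mnmBE mulmnE mnm1E eqxx mul1n subnn.
have nz_b : vlead i h != 0 by rewrite vlead_eq0.
have [lead_b max_b] := lexleadP nz_b.
suff -> : lexlead (vlead i h) = m' by split=> //; rewrite -/m Em lem_addr.
have m'b : m' \in msupp (vlead i h).
  by rewrite vleadE mcoeff_msupp mcoeff_vcoef m'i eqxx Emi -/m -Em -mcoeff_msupp.
have /lexleP[//|lt_m'] := max_b _ m'b.
move: lead_b; rewrite mcoeff_msupp {2}vleadE mcoeff_vcoef.
have [b0|_] := eqVneq (lexlead (vlead i h) i) 0%N; last by rewrite eqxx.
rewrite -mcoeff_msupp => /max_h /lexle_ltF; rewrite -/m Em Emi -/m.
by rewrite lexlt_add2r.
Qed.

Definition smaller S' S : Prop :=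
  (lvl S < lvl S' <= r)%N \/
  exists i, [/\ i = lvl S :> nat, i = lvl S' :> nat &
    (degsum i (sq S') < degsum i (sq S))%N \/
    ((degsum i (sq S') <= degsum i (sq S))%N /\ grows (LTset (sq S')) (LTset (sq S)))].

(** Lexicographic combination of the level, which is at most r, of [degsum] and of
    the ideal of leading terms. *)
Lemma wf_smaller : well_founded smaller.
Proof.
suff acc_lvl n S : (r - lvl S)%N = n -> Acc smaller S by move=> S; apply: acc_lvl (erefl _).
elim/ltn_ind: n S => n IHn S ES.
have up S' T : (r - lvl T)%N = n -> (lvl T < lvl S' <= r)%N -> Acc smaller S'.
  move=> ET /andP[lt_TS' le_S'r]; apply: (IHn (r - lvl S')%N) => //.
  by rewrite -ET ltn_sub2l // (leq_trans lt_TS').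
have [le_rS|lt_Sr] := leqP r (lvl S).
  constructor=> S' [lt_S|[i [Ei _ _]]]; first exact: up ES lt_S.
  by move: (ltn_ord i); rewrite Ei ltnNge le_rS.
pose i := Ordinal lt_Sr; have Ei : i = lvl S :> nat by [].
move: {lt_Sr} i Ei => i Ei.
have [d Ed] : exists d, degsum i (sq S) = d by eexists.
elim/ltn_ind: d S ES Ei Ed => d IHd S ES Ei Ed.
have wf_LT := Inverse_Image.wf_inverse_image _ _ _ (fun S => LTset (sq S)) (@wf_grows r).
have le_d : (degsum i (sq S) <= d)%N by rewrite Ed.
elim/(well_founded_ind wf_LT): S ES Ei {Ed} le_d => S IHS ES Ei le_d.
constructor=> S' [lt_S|[j [Ej Ej' less]]]; first exact: up ES lt_S.
have Eij : i = j by apply: val_inj; rewrite /= Ei Ej.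
rewrite -{}Eij in Ej Ej' less.
have ES' : (r - lvl S')%N = n by rewrite -Ej' Ei.
case: less => [lt_d|[le_d' grow]].
  by apply: (IHd _ (leq_trans lt_d le_d) S').
by apply: IHS => //; apply: leq_trans le_d.
Qed.

Lemma split_smaller S i M : semi_triangular S -> i = lvl S :> nat ->
  {in sq S &, forall f1 f2, f1 != f2 -> ~ divides (LT f1) (LT f2)} ->
  split_step S i M -> List.Forall (smaller^~ S) M.
Proof.
case: S => G T k g /= /semi_triangularE[/= le_kr _ _ _ tail_G] Ei red_G.
rewrite -Ei in tail_G *; have lt_ir := ltn_ord i.
case.
- rewrite /= uniF_expandF degT_vdeg LC_vlead => f h n a u Gf f_gt0.
  rewrite !inE => /andP[ne_hf Gh] h_gt0 le_hf Ea Eu.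
  have [Ef lt_u iu] := exact_division (tail_G _ Gf) (tail_G _ Gh) h_gt0 Ea Eu.
  constructor; [|constructor; [|by constructor]]; right; exists i; split=> //=.
    left; apply: leq_ltn_trans (degsumU1 _ _ _) _; rewrite (degsumD1 i Gf) ltn_add2r.
    exact: leq_trans lt_u le_hf.
  right; split.
    apply: leq_trans (degsumU1 _ _ _) _.
    by rewrite (vdeg_free (tailpoly_vlead (tail_G _ Gh))).
  have nz_h : h != 0 by apply: contraTneq h_gt0 => ->; rewrite /vdeg rmorph0 size_poly0.
  have nz_b : vlead i h != 0 by rewrite vlead_eq0.
  split; [exact: LTset_upset|exact: LTset_upset| |].
    by move=> m [x [Gx nz_x le_x]]; exists x; split=> //; rewrite in_fset1U Gx orbT.
  exists (lexlead (vlead i h)).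
    exists (vlead i h); split=> //; last exact/mnm_lepP.
    by rewrite in_fset1U eqxx.
  case=> x [Gx nz_x le_x].
  have [le_bh bi0] := lexlead_vlead (tail_G _ Gh) nz_h.
  have [Exh|ne_xh] := eqVneq x h.
    have /(_ i) := mnm_lepP le_x.
    by rewrite Exh -vdeg_lexlead ?tail_G // bi0 leqNgt h_gt0.
  apply: (red_G x h) => //; apply: divides_LT => //.
  exact: lepm_trans le_x le_bh.
- rewrite /= degT_vdeg => f Gf f_gt0 others0; apply/Forall_cons_iff; split.
    by left; rewrite branch_lastE /= ltnS leqnn.
  by apply/Forall_map_seq => n _; left; rewrite branchE /= ltnS leqnn.
- by rewrite /= => all0; constructor=> //; left; rewrite /= ltnS leqnn.
Qed.

End Splitting.

(** * Making a dense triangular system monic *)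

Lemma pass_identity (R : comNzRingType) (a a' h y B X c : R) : a' * a = 1 ->
  y * (h * X + c) =
  h * y * (X + - (a' * B) * c) + a' * (c * (B * (h * y) + a * y)).
Proof.
move=> E; transitivity (y * (h * X + (a' * a) * c)); first by rewrite E mul1r.
ring.
Qed.

Section Monic.
Variables (F : fieldType) (r : nat).
Local Notation P := {mpoly F[r]}.
Implicit Types (p q g h b c u a : P) (G H R : {fset P}) (k l n : nat) (i j : 'I_r).

Lemma monic_passE (f f' : 'I_r -> P) (n : 'I_r) : monic_pass f f' n <->
  let d := vdeg n (f n) in
  let h := vlead n (f n) in
  exists (ph : {poly F}) (j : nat) (beta : {poly F}) (alpha : F),
    [/\ is_minpoly n.+1 [fset f' i | i : 'I_r & (n < i)%N] h ph,
        alpha != 0,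
        ph = beta * 'X^(j.+1) + alpha *: 'X^j
      & f' n = 'X_n ^+ d + (- (alpha^-1 *: horner_alg h beta)) * (f n - h * 'X_n ^+ d)].
Proof. by rewrite /monic_pass degT_vdeg LC_vlead. Qed.

Lemma ideal_from_ideal k G p : ideal_from k G p -> ideal G p.
Proof. by apply: ideal_from_sub => // g; apply: ideal_gen. Qed.

Lemma divides_exp p q n : divides p q -> exists c, q ^+ n = c * p ^+ n.
Proof. by case=> c ->; exists (c ^+ n); rewrite exprMn. Qed.

Lemma horner_algXn h n : horner_alg h ('X^n : {poly F}) = h ^+ n.
Proof. by rewrite rmorphXn /= horner_algX. Qed.

Lemma horner_algZXn h n (c : F) : horner_alg h (c *: 'X^n) = c *: h ^+ n.
Proof. by rewrite linearZ /= horner_algXn mulr_algl. Qed.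

Section Correctness.
Variables (f f' : 'I_r -> P) (g : P).
Hypothesis pass : forall n : 'I_r, monic_pass f f' n.
Hypothesis lead_g : forall n : 'I_r, divides (vlead n (f n)) g.

Local Notation G := [fset f i | i : 'I_r].
Local Notation G' := [fset f' i | i : 'I_r].

(** With p_h = beta X^(j+1) + alpha X^j, the element p_h(h) of the ideal is
    alpha h^j (1 - h h'). So h' inverts h up to h^j modulo the later elements. *)
Lemma pass_relation (n : 'I_r) : exists (j : nat) y,
  ideal [fset f' i | i : 'I_r & (n < i)%N] y /\
  vlead n (f n) ^+ j * f n = vlead n (f n) ^+ j.+1 * f' n + y.
Proof.
have /monic_passE[ph [j [beta [alpha [[_ minp _] nz_a Eph Ef']]]]] := pass n.
set h := vlead n (f n) in minp Ef' *; set c := f n - _ in Ef'.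
exists j, (alpha^-1 *: (c * horner_alg h ph)); split.
  by rewrite -mul_mpolyC; do 2!apply: idealMl; apply: ideal_from_ideal minp.
have algp : horner_alg h ph = horner_alg h beta * h ^+ j.+1 + alpha%:MP * h ^+ j.
  by rewrite Eph rmorphD rmorphM /= horner_algZXn horner_algXn mul_mpolyC.
rewrite Ef' algp.
have Ef : f n = h * 'X_n ^+ vdeg n (f n) + c by rewrite addrC subrK.
rewrite {1}Ef -!mul_mpolyC; set B := horner_alg h beta; set X := 'X_n ^+ _.
have Ealpha : (alpha^-1)%:MP * alpha%:MP = 1 :> P by rewrite -mpolyCM mulVf.
by rewrite exprS; apply: pass_identity.
Qed.

Lemma pass_forward (n : 'I_r) : exists N, ideal G' (g ^+ N * f n).
Proof.
have [j [y [Gy Ey]]] := pass_relation n; exists j.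
have [c ->] := divides_exp j (lead_g n); rewrite -mulrA; apply: idealMl.
rewrite Ey; apply: ideal_fromD; first by apply/idealMl/ideal_gen/in_imfset.
by apply: ideal_subset Gy => x /imfsetP[/= i _ ->]; apply: in_imfset.
Qed.

(** Downward induction: the elements used in the pass come from later variables. *)
Lemma pass_backward (n : 'I_r) : exists N, ideal G (g ^+ N * f' n).
Proof.
have [m] := ubnP (r - n); elim: m n => // m IHm n lt_m.
have [j [y [Gy Ey]]] := pass_relation n.
have [N GNy] : exists N, ideal G (g ^+ N * y).
  apply: ideal_saturation Gy => x /imfsetP[/= i lt_ni ->]; apply: IHm.
  by apply: leq_trans (ltn_sub2l (ltn_ord n) lt_ni) _; rewrite -ltnS.
have [c Ec] := divides_exp j.+1 (lead_g n).
exists (N + j.+1)%N; rewrite exprD Ec -!mulrA.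
have -> : vlead n (f n) ^+ j.+1 * f' n = vlead n (f n) ^+ j * f n - y.
  by rewrite Ey addrK.
rewrite mulrBr mulrBr; apply: ideal_fromB; last by rewrite mulrCA; apply: idealMl.
by do 3!apply: idealMl; apply/ideal_gen/in_imfset.
Qed.

Lemma pass_in_radical : in_radical G g <-> in_radical G' g.
Proof.
split; apply: in_radical_transfer => _ /imfsetP[/= i _ ->].
  exact: pass_forward.
exact: pass_backward.
Qed.

End Correctness.

Lemma tailpoly_alg k h (s : {poly F}) : tailpoly k h -> tailpoly k (horner_alg h s).
Proof.
move=> kh; elim/poly_ind: s => [|s c IHs]; first by rewrite rmorph0 tailpoly_zero.
rewrite rmorphD rmorphM /= horner_algX horner_algC.
by apply: tailpolyD; [apply: tailpolyM|rewrite -mul_mpolyC mulr1 tailpolyC].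
Qed.

Lemma minpoly_dvd k G h (p q : {poly F}) : tailpoly k h -> is_minpoly k G h p ->
  ideal_from k G (horner_alg h q) -> p %| q.
Proof.
move=> kh [mon_p Gp min_p] Gq.
have Gr : ideal_from k G (horner_alg h (q %% p)).
  have -> : q %% p = q - q %/ p * p by rewrite {2}(divp_eq q p) addrC addKr.
  rewrite rmorphB rmorphM; apply: ideal_fromB => //.
  by apply: ideal_fromMl Gp; apply: tailpoly_alg.
apply: contraT; rewrite /dvdp => /min_p/(_ Gr).
by rewrite leqNgt ltn_modp monic_neq0.
Qed.

(** F[T_(k+1), ..., T_r] modulo the ideal of G has finite dimension over F. *)
Definition spanned k G : Prop := exists (I : finType) (e : I -> P),
  forall p, tailpoly k p -> exists v : I -> F, ideal_from k G (p - \sum_t v t *: e t).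

(** The powers 1, h, ..., h^N are linearly dependent in a space of dimension N. *)
Lemma minpoly_exists k G h : spanned k G -> tailpoly k h ->
  exists p : {poly F}, is_minpoly k G h p.
Proof.
case=> I [e span] kh; pose N := #|I|.
have [v Ev] : exists v : 'I_N.+1 -> I -> F,
    forall s : 'I_N.+1, ideal_from k G (h ^+ s - \sum_t v s t *: e t).
  have span_h (s : 'I_N.+1) : exists w : I -> F,
      ideal_from k G (h ^+ s - \sum_t w t *: e t) by apply/span/tailpolyXn.
  exact: fin_all_exists span_h.
(* Among the annihilating polynomials, one of least degree is wanted; n is its size. *)
have annih : exists n (q : {poly F}),
    [/\ q != 0, ideal_from k G (horner_alg h q) & size q = n].
  pose M := \matrix_(s < N.+1, t < N) v s (enum_val t).
  have /rowV0Pn[w /sub_kermxP wM nz_w] : kermx M != 0.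
    by rewrite kermx_eq0 /row_free neq_ltn ltnS rank_leq_col.
  exists (size (\poly_(s < N.+1) w 0 (inord s))), (\poly_(s < N.+1) w 0 (inord s)); split=> //.
    apply: contraNneq nz_w => q0; apply/eqP/rowP => s; rewrite mxE.
    have := coef_poly N.+1 (fun s => w 0 (inord s)) s.
    by rewrite q0 coef0 ltn_ord inord_val => <-.
  rewrite poly_def rmorph_sum /=.
  have -> : \sum_(s < N.+1) horner_alg h (w 0 (inord s) *: 'X^s) =
            \sum_(s < N.+1) w 0 s *: (h ^+ s - \sum_t v s t *: e t).
    have Es (s : 'I_N.+1) : horner_alg h (w 0 (inord s) *: 'X^s) = w 0 s *: h ^+ s.
      by rewrite inord_val horner_algZXn.
    under eq_bigr => s _ do rewrite Es.
    under [RHS]eq_bigr => s _ do rewrite scalerBr scaler_sumr.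
    rewrite sumrB exchange_big /= [X in _ - X]big1 ?subr0 // => t _.
    under eq_bigr => s _ do rewrite scalerA.
    rewrite -scaler_suml; have /rowP/(_ (enum_rank t)) := wM; rewrite !mxE.
    by under eq_bigr => s _ do rewrite mxE enum_rankK; move=> ->; rewrite scale0r.
  elim/big_ind: _ => [|a b|s _]; [exact: ideal_from0|exact: ideal_fromD|].
  by rewrite -mul_mpolyC; apply: ideal_fromMl => //; apply: tailpolyC.
have [n [q [nz_q Gq sz_q]] min_n] := ex_nat_min annih.
exists ((lead_coef q)^-1 *: q); split.
- by rewrite monicE lead_coefZ mulVf ?lead_coef_eq0.
- rewrite linearZ /= mulr_algl -mul_mpolyC; apply: ideal_fromMl Gq; exact: tailpolyC.
- move=> s nz_s Gs; rewrite size_scale ?invr_eq0 ?lead_coef_eq0 // sz_q.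
  by apply: min_n; exists s.
Qed.

Lemma valuation_decomposition (p : {poly F}) : p != 0 ->
  exists (j : nat) (beta : {poly F}) (alpha : F),
    alpha != 0 /\ p = beta * 'X^(j.+1) + alpha *: 'X^j.
Proof.
elim/poly_ind: p => [|q c IHq]; first by rewrite eqxx.
have [->|nz_c _] := eqVneq c 0; last first.
  by exists 0%N, q, c; split=> //; rewrite expr1 expr0 alg_polyC.
rewrite addr0 => nz_qX; have nz_q : q != 0.
  by apply: contraNneq nz_qX => ->; rewrite mul0r.
have [j [beta [alpha [nz_a ->]]]] := IHq nz_q; exists j.+1, beta, alpha; split=> //.
by rewrite mulrDl -mulrA -exprSr -scalerAl -exprSr.
Qed.

Lemma tailpoly_constE p : tailpoly r p -> p = (p@_0%MM)%:MP.
Proof.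
move=> /tailpolyP rp; apply/mpolyP => m; rewrite mcoeffC.
have [->|nz_m] := eqVneq m 0%MM; first by rewrite mulr1.
rewrite mulr0; apply/eqP; rewrite mcoeff_eq0; apply: contraNN nz_m => /rp/forallP m0.
by apply/eqP/mnmP => j; have := m0 j; rewrite ltn_ord mnm0E => /eqP.
Qed.

Section Existence.
Variable f' : 'I_r -> P.

Local Notation above k := [fset f' i | i : 'I_r & (k <= i)%N].

Definition monic_at i : Prop :=
  [/\ tailpoly i (f' i), vlead i (f' i) = 1 & (0 < vdeg i (f' i))%N].

(** Downward induction: by division by the monic f'_i, the products of the powers
    T_i^l with l less than its degree and of the generators for the later variables
    form a generating family. *)
Lemma above_spanned k : (k <= r)%N -> (forall i, (k <= i)%N -> monic_at i) ->
  spanned k (above k).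
Proof.
move=> le_kr; rewrite -(subKn le_kr); elim: (r - k)%N => [_|n IHn mon].
  rewrite subn0; exists unit, (fun=> 1) => p rp; exists (fun=> p@_0).
  rewrite big_const card_unit /= addr0 -mul_mpolyC mulr1 -tailpoly_constE // subrr.
  exact: ideal_from0.
have [le_rn|lt_nr] := leqP r n.
  have Er : (r - n.+1 = r - n)%N.
    by move: le_rn; rewrite subnS -subn_eq0 => /eqP->.
  by rewrite Er in mon *; apply: IHn.
have lt_kr : (r - n.+1 < r)%N by rewrite ltn_subrL (leq_ltn_trans _ lt_nr).
pose i := Ordinal lt_kr; have Ei : (r - n)%N = i.+1 by rewrite /= -subSn.
rewrite -[(r - n.+1)%N]/(i : nat) in mon *.
have [I [e span]] : spanned i.+1 (above i.+1).
  by rewrite -Ei; apply: IHn => j; rewrite Ei => lt_ij; apply: mon; apply: ltnW.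
have [if' lead1 deg_gt0] := mon i (leqnn i); pose d := vdeg i (f' i).
exists ('I_d * I)%type, (fun t : 'I_d * I => e t.2 * 'X_i ^+ t.1) => p ip.
have [m [a [u [+ lt_u /(_ ip if')[ia iu]]]]] := pseudo_division p deg_gt0.
rewrite lead1 expr1n mul1r => Ep.
have span_coef (l : 'I_d) : exists w : I -> F,
    ideal_from i.+1 (above i.+1) (vcoef i l u - \sum_t w t *: e t).
  by apply/span/tailpolyS_vcoef.
have [w Hw] := fin_all_exists span_coef.
exists (fun t : 'I_d * I => w t.1 t.2).
have -> : p - \sum_(t : 'I_d * I) w t.1 t.2 *: (e t.2 * 'X_i ^+ t.1) =
    a * f' i + \sum_(l < d) 'X_i ^+ l * (vcoef i l u - \sum_t w l t *: e t).
  rewrite Ep -addrA; congr (_ + _); rewrite {1}(vcoef_sum lt_u).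
  rewrite -(pair_bigA _ (fun (l : 'I_d) t => w l t *: (e t * 'X_i ^+ l))) /= -sumrB.
  apply: eq_bigr => l _; rewrite mulrBr mulrC mulr_sumr; congr (_ - _).
  by apply: eq_bigr => t _; rewrite -scalerAr mulrC.
apply: ideal_fromD.
  apply: ideal_fromMl => //; apply: ideal_from_gen.
  by apply/imfsetP; exists i => //=; apply: leqnn.
elim/big_ind: _ => [|x y|l _]; [exact: ideal_from0|exact: ideal_fromD|].
apply: ideal_fromMl; first by apply/tailpolyXn/tailpolyXU.
apply: ideal_from_sub (Hw l) => // _ /imfsetP[/= j lt_ij ->].
by apply: ideal_from_gen; apply/imfsetP; exists j => //=; apply: ltnW.
Qed.

End Existence.

Lemma monic_pass_ext (f f' f'' : 'I_r -> P) (n : 'I_r) :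
  (forall j, (n <= j)%N -> f' j = f'' j) -> monic_pass f f' n -> monic_pass f f'' n.
Proof.
move=> E /monic_passE pass; apply/monic_passE; rewrite -(E n (leqnn n)).
suff <- : [fset f' i | i : 'I_r & (n < i)%N] = [fset f'' i | i : 'I_r & (n < i)%N] by [].
apply/fsetP => x; apply/imfsetP/imfsetP => -[/= i lt_ni ->]; exists i => //.
  by rewrite E // ltnW.
by rewrite E // ltnW.
Qed.

Lemma monic_at_pass (n : 'I_r) g h' : tailpoly n g -> (0 < vdeg n g)%N -> tailpoly n.+1 h' ->
  monic_at (fun=> 'X_n ^+ vdeg n g + h' * (g - vlead n g * 'X_n ^+ vdeg n g)) n.
Proof.
move=> ng g_gt0 nh'; set d := vdeg n g; set c := g - _; set q := 'X_n ^+ d + _.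
have nlead : tailpoly n.+1 (vlead n g) by apply: tailpoly_vlead.
have nX : tailpoly n ('X_n ^+ d : P) by apply/tailpolyXn/tailpolyXU.
have tn (x : P) : tailpoly n.+1 x -> tailpoly n x by apply: tailpoly_leq.
have nz_g : g != 0 by apply: contraTneq g_gt0 => ->; rewrite /vdeg rmorph0 size_poly0.
have sz_c : (size (expand n c) <= d)%N by apply: size_drop_lead.
have Eq : expand n q = 'X^d + h'%:P * expand n c.
  by rewrite expandD expandM expandXn expandX eqxx (expand_tailpoly (ltnSn n) nh').
have sz_hc : (size (h'%:P * expand n c)%R < size ('X^d : {poly P})%R)%N.
  by rewrite size_polyXn ltnS mul_polyC (leq_trans (size_scale_leq _ _)).
split.
- apply: tailpolyD => //; apply: tailpolyM; first exact: tn.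
  by apply: tailpolyB => //; apply: tailpolyM => //; apply: tn.
- by rewrite /vlead Eq lead_coefDl // lead_coefXn.
- by rewrite /vdeg Eq size_polyDl // size_polyXn.
Qed.

(** The passes depend on later variables only, so the family is built from the
    last variable on, one value at a time. *)
Lemma monic_exists (f : 'I_r -> P) : (forall i, pivot (f i) i) ->
  exists f', forall n : 'I_r, monic_pass f f' n /\ monic_at f' n.
Proof.
move=> piv_f.
suff above m : exists f', forall n : 'I_r,
    (r - m <= n)%N -> monic_pass f f' n /\ monic_at f' n.
  by have [f' mon] := above r; exists f' => n; apply: mon; rewrite subnn.
elim: m => [|m [f' IHm]].
  by exists f => n; rewrite subn0 leqNgt ltn_ord.
have [le_rm|lt_mr] := leqP r m.
  exists f' => n _; apply: IHm; move: le_rm; rewrite -subn_eq0 => /eqP->; exact: leq0n.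
have lt_ir : (r - m.+1 < r)%N by rewrite ltn_subrL (leq_ltn_trans _ lt_mr).
pose i := Ordinal lt_ir; have Ei : (r - m)%N = i.+1 by rewrite /= -subSn.
rewrite -[(r - m.+1)%N]/(i : nat).
have /pivotP[ifi d_gt0] := piv_f i.
have [ph min_ph] : exists ph : {poly F},
    is_minpoly i.+1 [fset f' j | j : 'I_r & (i < j)%N] (vlead i (f i)) ph.
  apply: minpoly_exists; last exact: tailpoly_vlead.
  apply: above_spanned => [|j lt_ij]; first exact: ltn_ord.
  by have [] := IHm j; rewrite ?Ei.
have nz_ph : ph != 0 by apply: monic_neq0; case: min_ph.
have [j [beta [alpha [nz_alpha Eph]]]] := valuation_decomposition nz_ph.
pose h' := - (alpha^-1 *: horner_alg (vlead i (f i)) beta).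
pose q := 'X_i ^+ vdeg i (f i) + h' * (f i - vlead i (f i) * 'X_i ^+ vdeg i (f i)).
pose f'' (n : 'I_r) := if n == i then q else f' n.
have f''i : f'' i = q by rewrite /f'' eqxx.
have f''E (n : 'I_r) : (i < n)%N -> f' n = f'' n.
  by move=> lt_in; rewrite /f'' -val_eqE gtn_eqF.
exists f'' => n; rewrite leq_eqVlt => /predU1P[/val_inj<-|lt_in]; last first.
  have [|pass_n mon_n] := IHm n; first by rewrite Ei.
  split; last by rewrite /monic_at -f''E.
  by apply: monic_pass_ext pass_n => k le_nk; apply: f''E; apply: leq_trans le_nk.
split.
  apply/monic_passE; exists ph, j, beta, alpha; split=> //.
  suff <- : [fset f' n | n : 'I_r & (i < n)%N] = [fset f'' n | n : 'I_r & (i < n)%N] by [].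
  by apply/fsetP => x; apply/imfsetP/imfsetP => -[/= k lt_ik ->]; exists k => //; rewrite f''E.
rewrite /monic_at f''i; apply: monic_at_pass => //.
rewrite /h' -scaleN1r scalerA; apply/tailpolyZ/tailpoly_alg; exact: tailpoly_vlead.
Qed.

End Monic.

(** * Regularity of the free variables *)

Section Saturation.
Variables (F : fieldType) (r : nat).
Local Notation P := {mpoly F[r]}.
Implicit Types (p q f g h b c u x y : P) (G H R T : {fset P}) (k l n : nat) (i j : 'I_r).

Lemma vcoefD i l p q : vcoef i l (p + q) = vcoef i l p + vcoef i l q.
Proof. by rewrite /vcoef expandD coefD. Qed.

(** Ideal of the elements x that a product of powers of the leading coefficients
    brings into the ideal of the list, built one equation at a time. The equations
    are listed by increasing pivots, so the tail has the later variables. *)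
Fixpoint saturation (s : seq (P * 'I_r)) x : Prop :=
  if s is (f, i) :: s' then
    exists m y q, saturation s' y /\ vlead i f ^+ m * x = y + q * f
  else x = 0.

Fixpoint increasing_pivots (s : seq (P * 'I_r)) : Prop :=
  if s is (f, i) :: s' then
    [/\ pivot f i, forall t : P * 'I_r, t \in s' -> (i < t.2)%N & increasing_pivots s']
  else True.

Lemma saturationM s c x : saturation s x -> saturation s (c * x).
Proof.
elim: s c x => [|[f i] s IHs] c x /= => [->|[m [y [q [sy E]]]]]; first by rewrite mulr0.
exists m, (c * y), (c * q); split; first exact: IHs.
by rewrite mulrCA E mulrDr mulrA.
Qed.

Lemma saturationD s x y : saturation s x -> saturation s y -> saturation s (x + y).
Proof.
elim: s x y => [|[f i] s IHs] x y /= => [-> ->|]; first by rewrite addr0.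
case=> [m [x1 [p [sx Ex]]]] [n [y1 [q [sy Ey]]]].
exists (m + n)%N, (vlead i f ^+ n * x1 + vlead i f ^+ m * y1),
  (vlead i f ^+ n * p + vlead i f ^+ m * q); split.
  by apply: IHs; apply: saturationM.
rewrite exprD mulrDr -mulrA (mulrCA _ _ x) -mulrA Ex Ey !mulrDr mulrDl !mulrA.
by rewrite addrACA.
Qed.

Lemma saturationN s x : saturation s x -> saturation s (- x).
Proof. by rewrite -mulN1r; apply: saturationM. Qed.

(** The ideal is generated by polynomials in the variables from the first pivot on,
    so it may be tested on the coefficients in any earlier variable. *)
Lemma saturation_coef s i l x :
    (forall t : P * 'I_r, t \in s -> (i < t.2)%N) -> increasing_pivots s ->
  saturation s x -> saturation s (vcoef i l x).
Proof.
elim: s x => [|[f j] s IHs] x lt_i /= => [_ ->|[/pivotP[jf _] _ incr_s]].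
  by rewrite /vcoef rmorph0 coef0.
case=> m [y [q [sy E]]].
have lt_ij : (i < j)%N by apply: (lt_i (f, j)); rewrite inE eqxx.
have if0 : vdeg i f = 0%N by apply: tailpoly_free lt_ij jf.
have ih0 : vdeg i (vlead j f ^+ m) = 0%N.
  by apply: (tailpoly_free lt_ij); apply/tailpolyXn/tailpoly_vcoef.
exists m, (vcoef i l y), (vcoef i l q); split.
  by apply: IHs => // t st; apply: lt_i; rewrite inE st orbT.
by rewrite -vcoef_freeM // E vcoefD [q * f]mulrC vcoef_freeM // [f * _]mulrC.
Qed.

Lemma vcoef_lead_mul i p q : p != 0 -> q != 0 ->
  vcoef i (vdeg i p + vdeg i q) (p * q) = vlead i p * vlead i q.
Proof.
move=> nz_p nz_q; rewrite /vcoef expandM /vlead -lead_coefM lead_coefE.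
rewrite size_mul ?expand_eq0 // !size_expand // addSn addnS.
by [].
Qed.

Lemma vcoef_big i l p : (vdeg i p < l)%N -> vcoef i l p = 0.
Proof. by move=> lt_l; rewrite /vcoef nth_default // (leq_trans (size_expand_le i p)). Qed.

(** If c u = y + q f has smaller degree than f, the leading term of q f is
    cancelled by y; so the leading coefficient of q times h is in the ideal, and
    multiplying by h lowers the degree of q. *)
Lemma saturation_small s i f c u y q : (0 < vdeg i f)%N ->
    (forall t : P * 'I_r, t \in s -> (i < t.2)%N) -> increasing_pivots s ->
    vdeg i c = 0%N -> (vdeg i u < vdeg i f)%N ->
    saturation s y -> c * u = y + q * f ->
  exists m, saturation s (vlead i f ^+ m * (c * u)).
Proof.
move=> f_gt0 lt_i incr_s c0 lt_u.
(* c is generalized as it absorbs the powers of h. *)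
have [N] := ubnP (size (expand i q)); elim: N c y q c0 => // N IHN c y q c0 lt_q sy E.
have [q0|nz_q] := eqVneq q 0.
  by exists 0%N; rewrite expr0 mul1r E q0 mul0r addr0.
have nz_f := vdeg_gt0_neq0 f_gt0; set h := vlead i f; set e := vdeg i q.
have lead0 : vlead i q * h = - vcoef i (e + vdeg i f) y.
  apply/eqP; rewrite -vcoef_lead_mul // -addr_eq0 addrC -vcoefD -E vcoef_freeM //.
  by rewrite vcoef_big ?mulr0 // (leq_trans lt_u) ?leq_addl.
pose t := vlead i q * 'X_i ^+ e.
have sy2 : saturation s (h * y + h * (t * f)).
  apply: saturationD; first exact: saturationM.
  have -> : h * (t * f) = ('X_i ^+ e * f) * (vlead i q * h) by rewrite /t; ring.
  by rewrite lead0; apply/saturationM/saturationN/saturation_coef.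
have hc0 : vdeg i (h * c) = 0%N.
  have [->|nz_h] := eqVneq h 0; first by rewrite mul0r /vdeg rmorph0 size_poly0.
  by rewrite vdeg_freeM // vdeg_vlead.
have [||m sm] := IHN (h * c) (h * y + h * (t * f)) (h * (q - t)) hc0 _ sy2.
- rewrite ltnS in lt_q; apply: leq_trans lt_q.
  rewrite expandM (expand_free (vdeg_vlead i f)) mul_polyC.
  apply: leq_ltn_trans (size_scale_leq _ _) _.
  by apply: leq_ltn_trans (size_drop_lead i nz_q) _; rewrite size_expand.
- by rewrite -mulrA E; ring.
by exists m.+1; rewrite exprSr -mulrA [vlead i f * _]mulrA.
Qed.

(** By induction on the equations. Modulo f, and up to a power of h, x may be
    replaced by a remainder u of smaller degree, to which [saturation_small]
    applies. In the end the list is empty, and P is an integral domain. *)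
Lemma saturation_regular s c x : increasing_pivots s -> c != 0 ->
    (forall t : P * 'I_r, t \in s -> vdeg t.2 c = 0%N) ->
  saturation s (c * x) -> saturation s x.
Proof.
move=> + nz_c; elim: s x => [|[f i] s IHs] x /=.
  by move=> _ _ /eqP; rewrite mulf_eq0 (negbTE nz_c) => /eqP.
case=> /pivotP[if' f_gt0] lt_i incr_s c_free [m [y [q [sy Ecx]]]].
have ci0 : vdeg i c = 0%N by apply: (c_free (f, i)); rewrite inE eqxx.
have cs_free t : t \in s -> vdeg t.2 c = 0%N by move=> st; apply: c_free; rewrite inE st orbT.
have [n [a [u [Ex lt_u _]]]] := pseudo_division x f_gt0.
set h := vlead i f in Ecx Ex *.
have hX0 k : vdeg i (h ^+ k) = 0%N.
  have [->|nz_hk] := eqVneq (h ^+ k) 0; first by rewrite /vdeg rmorph0 size_poly0.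
  by rewrite /vdeg expandXn (expand_free (vdeg_vlead i f)) -rmorphXn size_polyC nz_hk.
have nz_h : h != 0 by rewrite vlead_eq0 (vdeg_gt0_neq0 f_gt0).
have hc0 : vdeg i (h ^+ m * c) = 0%N by rewrite vdeg_freeM ?expf_neq0.
have Eu : (h ^+ m * c) * u = h ^+ n * y + (h ^+ n * q - h ^+ m * c * a) * f.
  have -> : u = h ^+ n * x - a * f by rewrite Ex addrAC subrr add0r.
  transitivity (h ^+ n * (h ^+ m * (c * x)) - h ^+ m * c * a * f); first by ring.
  by rewrite Ecx; ring.
have [k sk] := saturation_small f_gt0 lt_i incr_s hc0 lt_u (saturationM (h ^+ n) sy) Eu.
have su : saturation s (h ^+ k * h ^+ m * u).
  apply: (IHs _ incr_s cs_free).
  by have -> : c * (h ^+ k * h ^+ m * u) = h ^+ k * (h ^+ m * c * u) by ring.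
exists (k + m + n)%N, (h ^+ k * h ^+ m * u), (h ^+ k * h ^+ m * a); split=> //.
by rewrite !exprD -mulrA Ex; ring.
Qed.

Lemma saturation_ideal s T g x :
    (forall t : P * 'I_r, t \in s -> t.1 \in T /\ divides (vlead t.2 t.1) g) ->
  saturation s x -> exists N, ideal T (g ^+ N * x).
Proof.
elim: s x => [|[f i] s IHs] x /= sT.
  by move=> ->; exists 0%N; rewrite mulr0; apply: ideal_from0.
case=> m [y [q [sy E]]].
have [|N TNy] := IHs y _ sy; first by move=> t st; apply: sT; rewrite inE st orbT.
have [Tf dvd_g] := sT (f, i) (mem_head _ _); have [c Ec] := divides_exp m dvd_g.
exists (N + m)%N; rewrite exprD Ec -mulrA; rewrite /= in E; rewrite -[c * _ * x]mulrA E.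
have -> : g ^+ N * (c * (y + q * f)) = c * (g ^+ N * y) + g ^+ N * c * q * f by ring.
by apply: ideal_fromD; apply: idealMl => //; apply: ideal_gen.
Qed.

Lemma in_ideal_saturation s T x : (forall f, f \in T -> exists i, (f, i) \in s) ->
  ideal T x -> saturation s x.
Proof.
move=> Ts; move: x; apply: ideal_from_ind => [|x y|c f _ /Ts[i]].
- by elim: s {Ts} => [|[f i] s IHs] //=; exists 0%N, 0, 0; rewrite mulr0 mul0r addr0.
- exact: saturationD.
elim: s {Ts} => // [[f' i'] s IHs]; rewrite inE => /predU1P[[<- <-]|/IHs sf] /=.
  exists 0%N, 0, c; rewrite expr0 mul1r add0r; split=> //.
  by elim: s {IHs} => [|[g j] s IHs] //=; exists 0%N, 0, 0; rewrite mulr0 mul0r addr0.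
by exists 0%N, (c * f), 0; rewrite expr0 mul1r mul0r addr0.
Qed.

(** Geometrically, every component of the locally closed set F_tri = 0, g <> 0
    dominates the affine space of the free variables. *)
Lemma free_variables_regular T g c x : triangular_shape T ->
    {in T, forall f i, pivot f i -> divides (vlead i f) g} ->
    c != 0 -> {in T, forall f i, pivot f i -> vdeg i c = 0%N} ->
  ideal T (c * x) -> exists N, ideal T (g ^+ N * x).
Proof.
case=> s [e [k [ET piv_e incr_k]]] lead_g nz_c c_free Tcx.
have Te (a : 'I_s) : e a \in T by rewrite ET; apply: in_imfset.
pose l := [seq (e a, k a) | a <- enum 'I_s].
have inl t : t \in l -> exists a : 'I_s, t = (e a, k a) by case/mapP=> a _; exists a.
have incr_l : increasing_pivots l.
  have : sorted ltn [seq val a | a <- enum 'I_s] by rewrite val_enum_ord iota_ltn_sorted.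
  rewrite /l; elim: (enum 'I_s) => //= a s' IHs' path_a; split=> //.
    move=> _ /mapP[b s'b ->]; apply: incr_k.
    by have /allP := order_path_min ltn_trans path_a; apply; apply: map_f.
  exact: IHs' (path_sorted path_a).
apply: (@saturation_ideal l) => [t /inl[a ->]|].
  by split; [exact: Te|exact: (lead_g _ (Te a) _ (piv_e a))].
apply: (saturation_regular incr_l nz_c) => [t /inl[a ->]|].
  exact: (c_free _ (Te a) _ (piv_e a)).
apply: in_ideal_saturation Tcx => f; rewrite ET => /imfsetP[/= a _ ->].
by exists (k a); apply/mapP; exists a; rewrite ?mem_enum.
Qed.

End Saturation.

(** * Free variables as scalars *)

Lemma fraction_clear (R : idomainType) (x : {fraction R}) :
  exists a c : R, c != 0 /\ FracField.tofrac c * x = FracField.tofrac a.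
Proof.
elim/quotW: x => x; exists (frac x).1, (frac x).2; split; first exact: denom_ratioP.
unlock FracField.tofrac; rewrite -[LHS]FracField.pi_mul; apply/eqmodP.
rewrite /= FracField.equivfE /FracField.mulf !numden_Ratio ?mul1r ?oner_eq0 ?denom_ratioP //.
by rewrite mulr1 mulrC.
Qed.

Lemma mpoly_rmorph_ext (R : comNzRingType) n (S : comNzRingType)
    (phi psi : {rmorphism {mpoly R[n]} -> S}) :
  (forall c, phi c%:MP = psi c%:MP) -> (forall i, phi 'X_i = psi 'X_i) -> phi =1 psi.
Proof.
move=> EC EX p; rewrite [p]mpolyE !rmorph_sum; apply: eq_bigr => m _.
rewrite -mul_mpolyC !rmorphM EC mpolyXE_id !rmorph_prod; congr (_ * _).
by apply: eq_bigr => i _; rewrite !rmorphXn EX.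
Qed.

(** Locked for the same reason as [expand]. *)
HB.lock Definition emb (F : fieldType) (r : nat) (V : {set 'I_r}) (f : {mpoly F[r]})
  : {mpoly (fracfield F V)[#|V|]} := embed V f.

Section Embedding.
Variables (F : fieldType) (r : nat) (V : {set 'I_r}).
Local Notation P := {mpoly F[r]}.
Local Notation A := {mpoly F[#|~: V|]}.
Local Notation Q := {mpoly (fracfield F V)[#|V|]}.
Local Notation emb := (@emb F r V).
Implicit Types (p f g h : P) (T : {fset P}) (i j : 'I_r) (a : 'I_#|V|) (b : 'I_#|~: V|).

Lemma embed_emb : @embed F r V = emb.
Proof. by rewrite emb.unlock. Qed.

Fact emb_zmod_morphism : zmod_morphism emb.
Proof. by rewrite -embed_emb => p q; apply: mmapB. Qed.

Fact emb_monoid_morphism : monoid_morphism emb.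
Proof. by rewrite -embed_emb; split=> [|p q]; [apply: rmorph1|apply: rmorphM]. Qed.

HB.instance Definition _ := GRing.isZmodMorphism.Build P Q emb emb_zmod_morphism.
HB.instance Definition _ := GRing.isMonoidMorphism.Build P Q emb emb_monoid_morphism.

(** The free variables have become scalars: [A] is the polynomial ring in them. *)
Definition const_free (t : A) : Q := (FracField.tofrac t)%:MP.

HB.instance Definition _ := GRing.RMorphism.copy const_free
  (@mpolyC #|V| (fracfield F V) \o @FracField.tofrac A).

Lemma embD p q : emb (p + q) = emb p + emb q.
Proof. exact: rmorphD. Qed.

Lemma embM p q : emb (p * q) = emb p * emb q.
Proof. exact: rmorphM. Qed.

Lemma embXn p n : emb (p ^+ n) = emb p ^+ n.
Proof. exact: rmorphXn. Qed.

Lemma emb0 : emb 0 = 0.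
Proof. exact: rmorph0. Qed.

Lemma const_freeM t1 t2 : const_free (t1 * t2) = const_free t1 * const_free t2.
Proof. exact: rmorphM. Qed.

Lemma embC c : emb c%:MP = const_free c%:MP.
Proof. by rewrite -embed_emb /embed mmapC. Qed.

Lemma embX i : emb 'X_i = embed_var F V i.
Proof. by rewrite -embed_emb /embed mmapX mmap1U. Qed.

Lemma embX_bound a : emb 'X_(enum_val a) = 'X_a.
Proof.
rewrite embX /embed_var; case: pickP => [a' /eqP/enum_val_inj->//|none].
by have := none a; rewrite eqxx.
Qed.

Lemma embX_free b : emb 'X_(enum_val b) = const_free 'X_b.
Proof.
rewrite embX /embed_var; case: pickP => [a /eqP Eab|_].
  by have := enum_valP b; rewrite -Eab inE enum_valP.
case: pickP => [b' /eqP/enum_val_inj->//|none].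
by have := none b; rewrite eqxx.
Qed.

Variant var_spec i : Type :=
  | VarBound a of i = enum_val a
  | VarFree b of i = enum_val b.

Lemma varP i : var_spec i.
Proof.
have [Vi|nVi] := boolP (i \in V).
  by apply: (@VarBound i (enum_rank_in Vi i)); rewrite enum_rankK_in.
have Vi : i \in ~: V by rewrite inE.
by apply: (@VarFree i (enum_rank_in Vi i)); rewrite enum_rankK_in.
Qed.

(** Both sides are ring morphisms, so it suffices to compare them on the variables.
    Degrees and leading coefficients in the variables kept can thus be computed
    before or after the embedding. *)
Lemma expand_emb a f : expand a (emb f) = map_poly emb (expand (enum_val a) f).
Proof.
apply: (mpoly_rmorph_ext (phi := @expand _ _ a \o emb)
  (psi := map_poly emb \o @expand _ _ (enum_val a))) f => [c|i] /=.
  by rewrite embC expandC expandC map_polyC /= embC.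
rewrite expandX; case: (varP i) => [a' ->|b ->].
  rewrite embX_bound expandX (inj_eq enum_val_inj); case: eqP => _.
    by rewrite map_polyX.
  by rewrite map_polyC /= embX_bound.
rewrite embX_free expandC; case: eqP => [Eb|_]; last by rewrite map_polyC /= embX_free.
by have := enum_valP b; rewrite inE Eb enum_valP.
Qed.

Definition rename_free (t : A) : P := mmap (@mpolyC r F) (fun b => 'X_(enum_val b)) t.

HB.instance Definition _ := GRing.RMorphism.copy rename_free
  (mmap (@mpolyC r F) (fun b => 'X_(enum_val b))).

Lemma rename_freeC c : rename_free c%:MP = c%:MP.
Proof. by rewrite /rename_free mmapC. Qed.

Lemma rename_freeX b : rename_free 'X_b = 'X_(enum_val b).
Proof. by rewrite /rename_free mmapX mmap1U. Qed.

Lemma emb_rename_free t : emb (rename_free t) = const_free t.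
Proof.
apply: (mpoly_rmorph_ext (phi := emb \o rename_free) (psi := const_free)) t => [c|b] /=.
  by rewrite rename_freeC embC.
by rewrite rename_freeX embX_free.
Qed.

Lemma const_free_eq0 t : (const_free t == 0) = (t == 0).
Proof. by rewrite /const_free mpolyC_eq0 tofrac_eq0. Qed.

Lemma rename_free_free a t : vdeg (enum_val a) (rename_free t) = 0%N.
Proof.
have E : expand (enum_val a) (rename_free t) = (rename_free t)%:P.
  apply: (mpoly_rmorph_ext (phi := @expand _ _ (enum_val a) \o rename_free)
     (psi := polyC \o rename_free)) t => [c|b] /=.
    by rewrite rename_freeC expandC.
  rewrite rename_freeX expandX; case: eqP => // Eb.
  by have := enum_valP b; rewrite inE Eb enum_valP.
by rewrite /vdeg E size_polyC; case: (_ == _).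
Qed.

Lemma rename_free_onto f : {in V, forall i, vdeg i f = 0%N} -> exists t, f = rename_free t.
Proof.
move=> f_free; pose k (m : 'X_{1..r}) := [multinom m (@enum_val _ (~: V) b) | b < #|~: V|].
exists (\sum_(m <- msupp f) f@_m *: 'X_[k m]); rewrite [LHS]mpolyE rmorph_sum.
apply: eq_big_seq => m mf; rewrite /= /rename_free mmapZ mmapX /= mul_mpolyC; congr (_ *: _).
rewrite mpolyXE_id (bigID (mem (~: V))) /= [X in _ * X]big1 ?mulr1 => [|i].
  by rewrite big_enum_val; apply: eq_bigr => b _; rewrite mnmE.
rewrite inE negbK => Vi; have /vdeg0P/(_ m mf)/eqP-> := f_free i Vi.
by rewrite expr0.
Qed.

(** Taking coefficients in the variables kept, one after the other, leads to
    polynomials in the free variables. *)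
Lemma emb_inj : injective emb.
Proof.
apply: raddf_inj => f; pose fixed (s : seq 'I_r) := forall g,
  (forall i, i \in V -> i \notin s -> vdeg i g = 0%N) -> emb g = 0 -> g = 0.
suff all_fixed s : fixed s.
  by apply: (all_fixed (enum 'I_r)) => i _; rewrite mem_enum.
elim: s => [|i s IHs] g g_free eg0.
  have [t Et] : exists t, g = rename_free t by apply: rename_free_onto => i Vi; apply: g_free.
  move/eqP: eg0; rewrite Et emb_rename_free const_free_eq0 => /eqP->; exact: rmorph0.
have [Vi|nVi] := boolP (i \in V); last first.
  apply: IHs eg0 => j Vj sj; apply: g_free => //; rewrite inE negb_or sj andbT.
  by apply: contraNneq nVi => <-.
pose a := enum_rank_in Vi i; have Ea : enum_val a = i by rewrite enum_rankK_in.
have coef0 l : vcoef i l g = 0.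
  apply: IHs; last first.
    have := congr1 (fun q : {poly Q} => q`_l) (expand_emb a g).
    by rewrite eg0 rmorph0 coef0 coef_map Ea.
  move=> j Vj sj; have [->|ne_ji] := eqVneq j i; first by apply/vdeg0P/vcoef_free.
  apply/vdeg0P; apply: (@vcoef_supported _ _ (fun m => m j == 0%N)) => [m _|].
    by rewrite mnmDE addn_eq0 => /andP[].
  by apply/vdeg0P/g_free; rewrite // inE negb_or ne_ji.
rewrite (vcoef_sum (leqnn (vdeg i g).+1)) big1 // => l _; by rewrite coef0 mul0r.
Qed.

Lemma clear_denominators (q : Q) : exists t f, t != 0 /\ const_free t * q = emb f.
Proof.
pose clear q := exists t f, t != 0 /\ const_free t * q = emb f.
have clearM q1 q2 : clear q1 -> clear q2 -> clear (q1 * q2).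
  case=> t1 [f1 [nz1 E1]] [t2 [f2 [nz2 E2]]]; exists (t1 * t2), (f1 * f2).
  by rewrite mulf_neq0 // const_freeM embM mulrACA E1 E2.
have clearX a : clear 'X_a.
  by exists 1, 'X_(enum_val a); rewrite oner_eq0 rmorph1 mul1r embX_bound.
rewrite [q]mpolyE; elim/big_ind: _ => [|q1 q2|m _].
- by exists 1, 0; rewrite oner_eq0 mulr0 rmorph0.
- case=> t1 [f1 [nz1 E1]] [t2 [f2 [nz2 E2]]].
  exists (t1 * t2), (rename_free t2 * f1 + rename_free t1 * f2); split; first exact: mulf_neq0.
  by rewrite embD !embM !emb_rename_free const_freeM -E1 -E2; ring.
- rewrite -mul_mpolyC mpolyXE_id; apply: (clearM).
    have [x [c [nz_c E]]] := fraction_clear q@_m; exists c, (rename_free x); split=> //.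
    by rewrite emb_rename_free /const_free -mpolyCM E.
  elim/big_ind: _ => [|q1 q2|a _].
  + by exists 1, 1; rewrite oner_eq0 mulr1 !rmorph1.
  + exact: clearM.
  + elim: (m a) => [|n IHn]; last by rewrite exprS; apply: clearM.
    by exists 1, 1; rewrite oner_eq0 expr0 mulr1 !rmorph1.
Qed.

End Embedding.

(** * The solvability test *)

Section Solvability.
Variables (K : fieldType) (r : nat).
Local Notation P := {mpoly K[r]}.
Implicit Types (f g h p x : P) (T : {fset P}) (i j : 'I_r) (S : system K r).

Lemma enum_val_ltn (V : {set 'I_r}) (a a' : 'I_#|V|) :
  (a < a')%N -> (enum_val a < enum_val a')%N.
Proof.
have sorted_V : sorted ltn [seq val i | i <- enum V].
  apply: (subseq_sorted ltn_trans (map_subseq _ (filter_subseq _ _))).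
  by rewrite -enumT val_enum_ord iota_ltn_sorted.
move=> lt_a; have lt_sz (b : 'I_#|V|) : (b < size (enum V))%N by rewrite -cardE.
have := sorted_ltn_nth ltn_trans 0%N sorted_V.
move=> /(_ a a'); rewrite !inE !size_map !lt_sz => /(_ isT isT lt_a).
by rewrite !(nth_map (enum_val a)) // -!enum_val_nth.
Qed.

Lemma vdeg_emb (V : {set 'I_r}) (a : 'I_#|V|) f :
  vdeg a (emb V f) = vdeg (enum_val a) f.
Proof. by rewrite /vdeg expand_emb size_map_inj_poly ?emb0 //; apply: emb_inj. Qed.

Lemma vlead_emb (V : {set 'I_r}) (a : 'I_#|V|) f :
  vlead a (emb V f) = emb V (vlead (enum_val a) f).
Proof. by rewrite /vlead expand_emb lead_coef_map_inj ?emb0 //; apply: emb_inj. Qed.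

Lemma pivot_emb (V : {set 'I_r}) (a : 'I_#|V|) f :
  pivot f (enum_val a) -> pivot (emb V f) a.
Proof.
move=> /pivotP[af f_gt0]; apply/pivotP; rewrite vdeg_emb; split=> //.
apply/forallP => a'; apply/implyP => lt_a'; rewrite vdeg_emb.
by apply/eqP; apply: tailpoly_free af; apply: enum_val_ltn.
Qed.

Lemma pivotsP T i : reflect (exists2 f, f \in T & pivot f i) (i \in pivots T).
Proof. by rewrite inE; apply: hasP. Qed.

Lemma pivot_unique T f g i : triangular_shape T -> f \in T -> g \in T ->
  pivot f i -> pivot g i -> f = g.
Proof.
case=> s [e [k [-> piv_e incr_k]]] /imfsetP[/= a _ ->] /imfsetP[/= b _ ->].
move=> /(pivot_inj (piv_e a)) Ea /(pivot_inj (piv_e b)) Eb.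
have [/incr_k|/incr_k|/val_inj->//] := ltngtP a b; by rewrite Ea Eb ltnn.
Qed.

Lemma triangular_pivot T f : triangular_shape T -> f \in T -> exists i, pivot f i.
Proof. by case=> s [e [k [-> piv_e _]]] /imfsetP[/= a _ ->]; exists (k a). Qed.

Lemma embed_systemE S : let V := pivots (tri S) in
  embed_system S = System fset0 [fset emb V f | f in tri S] #|V| (emb V (gpol S)).
Proof. by rewrite /embed_system /= !embed_emb. Qed.

(** Since pivots are distinct, the elements of F_tri may be numbered by them. *)
Lemma dense_family T : triangular_shape T -> let V := pivots T in
  exists e : 'I_#|V| -> P, (forall a, pivot (e a) (enum_val a)) /\ T = [fset e a | a : 'I_#|V|].
Proof.
move=> shape_T V; have ex_e (a : 'I_#|V|) : exists f, f \in T /\ pivot f (enum_val a).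
  by have /pivotsP[f] := enum_valP a; exists f.
have [e He] := fin_all_exists ex_e; exists e; split=> [a|]; first by case: (He a).
apply/fsetP => f; apply/idP/imfsetP => [Tf|[/= a _ ->]]; last by case: (He a).
have [i piv_f] := triangular_pivot shape_T Tf.
have Vi : i \in V by apply/pivotsP; exists f.
exists (enum_rank_in Vi i) => //.
have [Te piv_e] := He (enum_rank_in Vi i); rewrite enum_rankK_in // in piv_e.
exact: pivot_unique shape_T Tf Te piv_f piv_e.
Qed.

Section Descent.
Variables (T : {fset P}) (g : P).
Hypothesis shape_T : triangular_shape T.
Hypothesis lead_g : {in T, forall f i, pivot f i -> divides (vlead i f) g}.
Local Notation V := (pivots T).

(** An expression of g^n over L has a common denominator c, and c is regular modulo
    the saturated ideal over K. *)
Lemma emb_in_radical :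
  in_radical [fset emb V f | f in T] (emb V g) <-> in_radical T g.
Proof.
split=> -[n]; last first.
  move=> Tg; exists n; rewrite -embXn; move: (g ^+ n) Tg.
  apply: ideal_from_ind => [|p q Tp Tq|c f _ Tf].
  - by rewrite emb0; apply: ideal_from0.
  - by rewrite embD; apply: ideal_fromD.
  - by rewrite embM; apply/idealMl/ideal_gen/in_imfset.
suff descend y : ideal [fset emb V f | f in T] y ->
    exists (t : {mpoly K[#|~: V|]}) p, [/\ t != 0, ideal T p & const_free t * y = emb V p].
  case/descend=> t [p [nz_t Tp]].
  rewrite -emb_rename_free -embXn -embM => /emb_inj Ep; rewrite -Ep in Tp.
  have nz_c : rename_free t != 0.
    apply: contraNneq nz_t => t0; rewrite -(const_free_eq0 t) -emb_rename_free t0.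
    by rewrite emb0.
  have c_free : {in T, forall f i, pivot f i -> vdeg i (rename_free t) = 0%N}.
    move=> f Tf i piv_f; have Vi : i \in V by apply/pivotsP; exists f.
    by rewrite -(enum_rankK_in Vi Vi) rename_free_free.
  have [N] := free_variables_regular shape_T lead_g nz_c c_free Tp.
  by rewrite -exprD => Tg; exists (N + n)%N.
move: y; apply: ideal_from_ind => [|x y [t1 [p1 [nz1 T1 E1]]] [t2 [p2 [nz2 T2 E2]]]|c x _].
- by exists 1, 0; rewrite oner_eq0 mulr0 emb0; split=> //; apply: ideal_from0.
- exists (t1 * t2), (rename_free t2 * p1 + rename_free t1 * p2); split; first exact: mulf_neq0.
    by apply: ideal_fromD; apply: idealMl.
  by rewrite embD !embM !emb_rename_free const_freeM -E1 -E2; ring.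
case/imfsetP=> /= f Tf ->; have [t [p [nz_t Ep]]] := clear_denominators c.
exists t, (p * f); split=> //; first exact/idealMl/ideal_gen.
by rewrite mulrA Ep embM.
Qed.

Lemma emb_lead (a : 'I_#|V|) y : y \in [fset emb V f | f in T] -> pivot y a ->
  divides (vlead a y) (emb V g).
Proof.
case/imfsetP=> /= f Tf -> piv_x; have [i piv_f] := triangular_pivot shape_T Tf.
have Vi : i \in V by apply/pivotsP; exists f.
have Ei := enum_rankK_in Vi Vi; rewrite -Ei in piv_f.
have Ea := pivot_inj (pivot_emb piv_f) piv_x; rewrite {}Ea in Ei piv_f.
rewrite vlead_emb; have [c ->] := lead_g Tf piv_f.
by exists (emb V c); rewrite embM.
Qed.

End Descent.

Lemma MakeMonic_in_radical S
    (M : system (fracfield K (pivots (tri S))) #|pivots (tri S)|) :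
  semi_triangular S -> MakeMonic (embed_system S) M ->
  in_radical (tri M) (gpol M) <-> in_radical (tri S) (gpol S).
Proof.
move=> /semi_triangularE[_ shape_T lead_g _ _]; rewrite embed_systemE /=.
case=> f [f' [/= Ef piv_f pass ->]] /=.
rewrite -(emb_in_radical shape_T lead_g) Ef; symmetry; apply: pass_in_radical => // n.
by apply: (emb_lead shape_T lead_g); [rewrite Ef; apply: in_imfset|apply: piv_f].
Qed.

Lemma MakeMonic_exists S : semi_triangular S ->
  exists (M : system (fracfield K (pivots (tri S))) #|pivots (tri S)|)
      (q : {poly fracfield K (pivots (tri S))}),
    MakeMonic (embed_system S) M /\ is_minpoly 0 (tri M) (gpol M) q.
Proof.
move=> /semi_triangularE[_ shape_T lead_g _ _]; rewrite embed_systemE.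
have [e [piv_e ET]] := dense_family shape_T; set V := pivots (tri S) in e piv_e ET *.
have piv_emb (a : 'I_#|V|) : pivot (emb V (e a)) a by apply: pivot_emb.
have [f' mon] := monic_exists piv_emb.
pose M := System fset0 [fset f' i | i : 'I_#|V|] #|V| (emb V (gpol S)).
have [q min_q] : exists q : {poly _}, is_minpoly 0 (tri M) (gpol M) q.
  apply: minpoly_exists; last exact: tailpoly0.
  have -> : tri M = [fset f' i | i : 'I_#|V| & (0 <= i)%N].
    by apply/fsetP => y; apply/imfsetP/imfsetP => -[/= i _ ->]; exists i.
  by apply: above_spanned => // i _; case: (mon i).
exists M, q; split=> //; exists (fun a => emb V (e a)), f'; split=> // [|n].
  2: by case: (mon n).
apply/fsetP => x /=; rewrite ET; apply/imfsetP/imfsetP => -[/= y].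
  by case/imfsetP=> /= a _ -> ->; exists a.
by move=> _ ->; exists (e y) => //; apply: in_imfset.
Qed.

Lemma dvdp_Xn (F : fieldType) (p : {poly F}) n : p \is monic -> p %| 'X^n -> exists k, p = 'X^k.
Proof.
rewrite -['X]subr0 -polyC0 => mon_p /dvdp_exp_XsubCP[k _ Ep]; exists k.
by apply/eqP; rewrite -eqp_monic // monic_exp // monicXsubC.
Qed.

Lemma triangular_constants S : triangular S -> ~ has_nonzero_constant (sq S) ->
  {in sq S, forall f, f = 0}.
Proof.
case=> _ sq_const no_const f Sf; have [c Ec] := sq_const f Sf.
have [c0|nz_c] := eqVneq c 0; first by rewrite Ec c0 mpolyC0.
by case: no_const; exists c; rewrite -?Ec.
Qed.

(** If F_sq contains a nonzero constant, the ideal is everything. Otherwise F_sq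
    consists of zero at most and may be ignored. *)
Lemma IsSolvable_sound S b : IsSolvable S b -> if b then ~ unsolvable S else unsolvable S.
Proof.
case=> [_ [c nz_c Sc]|S' p n triS _ monS [_ + _]|S' p triS no_const monS min_p not_Xn].
- exists 0%N; rewrite expr0; have <- : (c^-1)%:MP * c%:MP = 1 :> P by rewrite -mpolyCM mulVf.
  by apply/idealMl/ideal_gen; rewrite inE Sc.
- move=> + Ep; rewrite Ep horner_algXn => Sn.
  have /(MakeMonic_in_radical (proj1 triS) monS)[k Sk] :
    in_radical (tri S') (gpol S') by exists n.
  by exists k; apply: ideal_subset Sk => x Tx; rewrite inE Tx orbT.
- move=> unsol; have [n Sn] : in_radical (tri S') (gpol S').
    apply/(MakeMonic_in_radical (proj1 triS) monS); apply: in_radical_sub unsol => x.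
    apply: ideal_sub => f; rewrite inE => /orP[Sf|Tf]; last exact: ideal_gen.
    by rewrite (triangular_constants triS no_const Sf); apply: ideal_from0.
  have [mon_p _ _] := min_p.
  have [|k] := dvdp_Xn mon_p (_ : p %| 'X^n); last exact: not_Xn.
  by apply: (minpoly_dvd _ min_p); [apply: tailpoly0|rewrite horner_algXn].
Qed.

Lemma IsSolvable_exists S : triangular S -> exists b, IsSolvable S b.
Proof.
move=> triS; case: (classic (has_nonzero_constant (sq S))) => [const|no_const].
  by exists false; apply: IsSolvableConst.
have [S' [p [monS min_p]]] := MakeMonic_exists (proj1 triS).
case: (classic (exists n, p = 'X^n)) => [[n Ep]|not_Xn].
  by exists false; apply: IsSolvableMonomial monS min_p Ep.
by exists true; apply: IsSolvableOther monS min_p _ => // n Ep; apply: not_Xn; exists n.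
Qed.

End Solvability.

(** * Executions of the algorithm *)

Section Execution.
Variables (K : fieldType) (r : nat).
Local Notation P := {mpoly K[r]}.
Implicit Types (S : system K r) (M : seq (system K r)) (b : bool).

(** The value that the test of all the systems in [M] has to return. *)
Definition answers b M : Prop :=
  if b then List.Forall (@unsolvable K r) M else ~ List.Forall (@unsolvable K r) M.

Lemma returns_Testing b M : List.Forall (@triangular K r) M -> answers b M ->
  returns b (Testing M).
Proof.
elim: M => [_ ans|S M IHM /Forall_cons_iff[triS triM] ans].
  apply: ReturnsLater => [|s' step_s']; first by exists (Returned K r true); apply: StepNil.
  inversion step_s'; case: b ans => // ans; first exact: ReturnsNow.
  by case: ans; constructor.
apply: ReturnsLater => [|s' step_s'].
  have [[] solS] := IsSolvable_exists triS.
    by exists (Returned K r false); apply: StepSolvable.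
  by exists (Testing M); apply: StepUnsolvable.
inversion step_s' as [| |S0 M0 solS|S0 M0 solS|]; subst.
  have nunsol := IsSolvable_sound solS; case: b ans {IHM step_s'} => /= ans.
    by case: nunsol; apply: List.Forall_inv ans.
  exact: ReturnsNow.
have unsol := IsSolvable_sound solS; apply: IHM => //.
case: b ans {step_s'} => /= ans; first exact: List.Forall_inv_tail ans.
by move=> unsolM; apply: ans; constructor.
Qed.

(** Reduction changes neither the ideal nor the shape of a system, and whatever is
    smaller than the reduced system is smaller than the original one. *)
Lemma reduced_system S (i : 'I_r) R :
    semi_triangular S -> i = lvl S :> nat -> is_red (sq S) R ->
  let S1 := System R (tri S) (lvl S) (gpol S) in
  [/\ semi_triangular S1, unsolvable S1 <-> unsolvable S,
      {in sq S1 &, forall f1 f2, f1 != f2 -> ~ divides (LT f1) (LT f2)}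
    & forall S', smaller S' S1 -> smaller S' S].
Proof.
move=> /semi_triangularE[le_r shape_T lead_T piv_T tail_S] Ei red_R.
have [|tail_R le_deg] := red_level red_R (i := i); first by rewrite Ei.
have [_ min_R sLT sId] := red_R; split=> //.
- by apply/semi_triangularE; split=> //; rewrite -?Ei.
- apply: in_radical_eq => p; rewrite inE => /orP[Rp|Tp];
    try by apply: ideal_gen; rewrite inE Tp orbT.
    have /sId : ideal R p by apply: ideal_gen.
    by apply: ideal_subset => x Sx; rewrite inE Sx.
  have /sId : ideal (sq S) p by apply: ideal_gen.
  by apply: ideal_subset => x Sx; rewrite inE Sx.
move=> S' [lt_lvl|[j [/= Ej Ej' less]]]; [by left|right].
have Eij : i = j by apply: val_inj; rewrite /= Ei Ej.
exists j; split=> //; rewrite -{}Eij in less *; case: less => [lt_d|[le_d grow]].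
  by left; apply: leq_trans lt_d le_deg.
right; split; first exact: leq_trans le_d le_deg.
have sR m : LTset (sq S) m -> LTset R m by apply: red_LTset.
have [up' upR sRS' [m S'm nRm]] := grow; split=> //; first exact: LTset_upset.
  by move=> m' /sR /sRS'.
by exists m => // /sR.
Qed.

Lemma MakeTriangular_step_sound M M' : List.Forall (@semi_triangular K r) M ->
  MakeTriangular_step M M' ->
  [/\ List.Forall (@semi_triangular K r) M', replace_step (@smaller K r) M' M
    & List.Forall (@unsolvable K r) M <-> List.Forall (@unsolvable K r) M'].
Proof.
move=> + step; case: step => M1 S M2 i R N Ei red_R split_S.
rewrite !List.Forall_app Forall_cons_iff => -[semi1 [semiS semi2]].
have [semiS1 unsolS1 min_R less_S1] := reduced_system semiS Ei red_R.
have semiN := split_semi_triangular semiS1 Ei split_S.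
have unsolN := split_unsolvable semiS1 Ei split_S.
have lessN := split_smaller semiS1 Ei min_R split_S.
split; first by rewrite ?List.Forall_app; split=> //; split.
  by constructor; apply: List.Forall_impl lessN => S'; apply: less_S1.
have unsolSN : unsolvable S <-> List.Forall (@unsolvable K r) N.
  by split=> [/unsolS1/unsolN|/unsolN/unsolS1].
by rewrite ?List.Forall_app ?Forall_cons_iff unsolSN.
Qed.

Lemma ex_unfinished M : ~~ all (fun S => ~~ (lvl S < r)%N) M ->
  exists M1 S M2, M = M1 ++ S :: M2 /\ (lvl S < r)%N.
Proof.
elim: M => //= S M IHM; rewrite negb_and negbK => /orP[lt_r|/IHM].
  by exists [::], S, M.
by case=> M1 [S' [M2 [-> lt_r]]]; exists (S :: M1), S', M2.
Qed.

Lemma finished_triangular S : semi_triangular S -> ~~ (lvl S < r)%N -> triangular S.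
Proof.
move=> semiS; rewrite -leqNgt => le_r; split=> // f Sf.
have /semi_triangularE[le_lvl _ _ _ tail_S] := semiS.
by exists f@_0%MM; apply: tailpoly_constE; apply: tailpoly_leq le_r (tail_S _ Sf).
Qed.

(** By induction on the multiset order that [smaller] induces on lists of systems. *)
Lemma returns_Triangulating b M : List.Forall (@semi_triangular K r) M -> answers b M ->
  returns b (Triangulating M).
Proof.
elim/(well_founded_ind (wf_replace_step (@wf_smaller K r))): M => M IHM semiM ans.
apply: ReturnsLater => [|s' step_s'].
  have [done_M|/ex_unfinished[M1 [S [M2 [EM lt_r]]]]] :=
      boolP (all (fun S => ~~ (lvl S < r)%N) M).
    by exists (Testing M); apply: StepTriangularDone.
  have [R red_R] := red_exists (sq S); pose i := Ordinal lt_r.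
  have semiS : semi_triangular S.
    by move: semiM; rewrite EM List.Forall_app Forall_cons_iff => -[_ []].
  have [semiS1 _ _ _] := reduced_system semiS (erefl : i = lvl S :> nat) red_R.
  have [N split_S] := split_exists semiS1 (erefl : i = lvl S :> nat).
  exists (Triangulating (M1 ++ N ++ M2)); rewrite EM; apply: StepTriangular.
  exact: MakeTriangularStep red_R split_S.
inversion step_s' as [M0 M' step_M|M0 done_M| | |]; subst.
  have [semiM' less_M' unsolM] := MakeTriangular_step_sound semiM step_M.
  apply: IHM => //; case: b ans {step_s'} => /= [/unsolM//|ans /unsolM]; exact: ans.
apply: returns_Testing ans; elim: M semiM done_M {IHM step_s'} => [|S M IHM].
  by constructor.
move=> /Forall_cons_iff[semiS semiM] /= /andP[finS finM].
by constructor; [apply: finished_triangular|apply: IHM].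
Qed.

End Execution.

Theorem mainTheorem1 (K : fieldType) (r s : nat)
    (f : 'I_s -> {mpoly K[r]}) (I : {mpoly K[r]} -> Prop)
    (hI : forall p : {mpoly K[r]},
        I p <-> exists c : 'I_s -> {mpoly K[r]}, p = \sum_(a < s) c a * f a) :
  ((exists mu : 'X_{1..r}, I 'X_[mu]) -> ContainsMonomial_returns f true) /\
  (~ (exists mu : 'X_{1..r}, I 'X_[mu]) -> ContainsMonomial_returns f false).
Proof.
set S0 := System [fset f a | a : 'I_s] fset0 0 (\prod_(i < r) 'X_i : {mpoly K[r]}).
have IE p : I p <-> ideal [fset f a | a : 'I_s] p.
  rewrite hI; split=> [[c ->]|].
    elim/big_ind: _ => [|x y|a _]; [exact: ideal_from0|exact: ideal_fromD|].
    by apply/idealMl/ideal_gen/in_imfset.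
  move: p; apply: ideal_from_ind => [|x y [c ->] [d ->]|c x _ /imfsetP[/= a _ ->]].
  - by exists (fun=> 0); rewrite big1 // => a _; rewrite mul0r.
  - exists (fun a => c a + d a); rewrite -big_split /=.
    by apply: eq_bigr => a _; rewrite mulrDl.
  - exists (fun a' => if a' == a then c else 0); rewrite (bigD1 a) //= eqxx big1 ?addr0 //.
    by move=> a' /negbTE->; rewrite mul0r.
have prod_exp n : (\prod_(i < r) 'X_i : {mpoly K[r]}) ^+ n = 'X_[[multinom n | i < r]].
  by rewrite mpolyXE_id -prodrXl; apply: eq_bigr => i _; rewrite mnmE.
have unsolS0 : unsolvable S0 <-> exists mu, I 'X_[mu].
  rewrite /unsolvable /= fsetU0; split=> [[n]|[mu /IE Imu]].
    by rewrite prod_exp => In; exists [multinom n | i < r]; apply/IE.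
  (* Each exponent of mu is at most its total degree. *)
  exists (mdeg mu); rewrite prod_exp.
  have le_mu : (mu <= [multinom mdeg mu | i < r])%MM.
    by apply/mnm_lepP => i; rewrite mnmE mdegE (bigD1 i) //= leq_addr.
  by rewrite -(submK le_mu) mpolyXD; apply: idealMl.
have semiS0 : semi_triangular S0.
  apply/semi_triangularE; split=> //= [|x _]; last exact: tailpoly0.
  exists 0%N, (fun=> 0),
    (fun a : 'I_0 => match a with Ordinal _ lt_a => False_rect _ (notF lt_a) end).
  split=> [|[]//|[]//]; apply/fsetP => x; rewrite in_fset0; apply/esym/imfsetP => -[[]].
  done.
have run b : answers b [:: S0] -> ContainsMonomial_returns f b.
  by move=> ans; apply: returns_Triangulating => //; constructor.
split=> [Imu|nImu]; apply: run.
  by constructor=> //; apply/unsolS0.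
by move=> unsol; apply: nImu; apply/unsolS0; apply: List.Forall_inv unsol.
Qed.
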